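(* If there exists a separable $\mathrm{II}_1$ factor $M$ such that $\mathcal G(M)>0$, then there exist separable $\mathrm{II}_1$ factors which are not singly generated.
   Context: For a $\mathrm{II}_1$ factor $M$ with its faithful normal trace $\tau$, $\tau(1)=1$, let $\mathcal P(M)$ be the collection of all finite sets of mutually orthogonal projections in $M$ which sum to $1$. For $x\in M$ and $P\in\mathcal P(M)$ put $\mathcal I(x;P)=\sum_{p,q\in P,\ pxq\neq 0}\tau(p)\tau(q)$. For a finite subset $X\subset M$ put $\mathcal I(X;P)=\sum_{x\in X}\mathcal I(x;P)$ and $\mathcal I(X)=\inf_{P\in\mathcal P(M)}\mathcal I(X;P)$. $W^*(X)$ denotes the von Neumann algebra generated by $X$ (not automatically assumed to contain the identity of $M$). The generator invariant is $\mathcal G(M)=\inf\{\mathcal I(X): X\subset M\text{ finite},\ W^*(X)=M\}$, with $\mathcal G(M)=\infty$ if $M$ is not finitely generated. $M$ is singly generated if $M=W^*(\{x\})$ for some $x\in M$. *)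

(* Defs.v *)
From HB Require Import structures.
From mathcomp Require Import all_boot all_order all_algebra.
From mathcomp Require Import complex.
From mathcomp Require Import all_classical all_reals all_analysis.

Set Implicit Arguments.
Unset Strict Implicit.
Unset Printing Implicit Defensive.

Import Order.TTheory GRing.Theory Num.Theory.
Import numFieldNormedType.Exports.

Local Open Scope classical_set_scope.
Local Open Scope ring_scope.
Local Open Scope complex_scope.

(* The inner product is linear in the first variable. *)
Record hilbertSpace (R : realType) := HilbertSpace {
  hilbert_sort :> completeNormedModType R[i] ;
  inner : {dot hilbert_sort for Num.conj} ;
  inner_norm : forall u : hilbert_sort, inner u u = `|u| ^+ 2
}.
Arguments inner {R h}.

Definition separable (T : topologicalType) :=
  exists2 S : set T, countable S & dense S.

Section operators.
Context {R : realType} {H : hilbertSpace R}.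
Implicit Types (S T p x y z : H -> H) (M N X P D : set (H -> H)).

Definition bounded_operator T :=
  linear T /\ exists k : R[i], forall u, `|T u| <= k * `|u|.

Definition is_adjoint S T := forall u v, inner (S u) v = inner u (T v).

Definition self_adjoint T := is_adjoint T T.

Definition projection p :=
  [/\ bounded_operator p, self_adjoint p & p \o p = p].

(* R[i] carries the partial order in which a <= b means that b - a is a
   nonnegative real; over the complex scalars this makes T - S self-adjoint. *)
Definition op_le S T := forall u, inner (S u) u <= inner (T u) u.

(* The operators S such that |<(T - S) u, v>| < e for all (u, v) in F, where F
   is finite and e > 0, form a base of neighbourhoods of T in the weak operator
   topology. *)
Definition wot_closed M := forall T, bounded_operator T ->
  (forall (F : seq (H * H)) (e : R[i]), 0 < e ->
    exists2 S, M S & {in F, forall uv, `|inner (T uv.1 - S uv.1) uv.2| < e}) ->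
  M T.

(* The identity operator is not required to belong to M. *)
Definition von_neumann_algebra M :=
  [/\ M `<=` bounded_operator,
      [/\ M 0,
          (forall (a : R[i]) S T, M S -> M T -> M (a *: S + T)),
          (forall S T, M S -> M T -> M (S \o T)) &
          (forall S, M S -> exists2 T, M T & is_adjoint S T)] &
      wot_closed M].

Definition Wstar X : set (H -> H) := smallest von_neumann_algebra X.

Definition factor M :=
  [/\ von_neumann_algebra M, M idfun, (idfun : H -> H) <> 0 &
      forall z, M z -> (forall y, M y -> z \o y = y \o z) ->
        exists c : R[i], z = c *: (idfun : H -> H)].

Definition finite_algebra M := forall v w, M v -> M w -> is_adjoint v w ->
  w \o v = idfun -> v \o w = idfun.

Definition abelian_projection M e :=
  [/\ M e, projection e &
      forall S T, M S -> M T ->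
        (e \o S \o e) \o (e \o T \o e) = (e \o T \o e) \o (e \o S \o e)].

(* Type II_1 in the Murray-von Neumann classification; such a factor has a
   unique faithful normal tracial state. *)
Definition II1_factor M :=
  [/\ factor M, finite_algebra M & forall e, abelian_projection M e -> e = 0].

Definition upward_directed D :=
  forall S T, D S -> D T -> exists U, [/\ D U, op_le S U & op_le T U].

Definition op_lub M D x :=
  [/\ M x, self_adjoint x, (forall S, D S -> op_le S x) &
      forall y, M y -> self_adjoint y -> (forall S, D S -> op_le S y) ->
        op_le x y].

(* Only the values of tau on M matter. *)
Definition faithful_normal_trace M (tau : (H -> H) -> R[i]) :=
  [/\ (forall (a : R[i]) S T, M S -> M T ->
         tau (a *: S + T) = a * tau S + tau T),
      tau idfun = 1,
      (forall S T, M S -> M T -> tau (S \o T) = tau (T \o S)),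
      (forall S T, M S -> M T -> is_adjoint S T ->
         0 <= tau (T \o S) /\ (tau (T \o S) = 0 -> S = 0)) &
      (forall D x, D !=set0 -> D `<=` M -> (forall S, D S -> op_le 0 S) ->
         upward_directed D -> op_lub M D x ->
         complex.Re (tau x) = sup [set complex.Re (tau S) | S in D])].

Definition projection_partition M P :=
  [/\ finite_set P,
      (forall p, P p -> M p /\ projection p),
      (forall p q, P p -> P q -> p <> q -> p \o q = 0) &
      \sum_(p \in P) p = idfun].

(* The numbers tau p are nonnegative reals when p is a projection of M. *)
Definition I_elt (tau : (H -> H) -> R[i]) x P : R :=
  \sum_(pq \in [set pq : (H -> H) * (H -> H) |
                 [/\ P pq.1, P pq.2 & pq.1 \o x \o pq.2 <> 0]])
    complex.Re (tau pq.1) * complex.Re (tau pq.2).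

Definition I_part (tau : (H -> H) -> R[i]) X P : R :=
  \sum_(x \in X) I_elt tau x P.

Definition I_set M (tau : (H -> H) -> R[i]) X : \bar R :=
  ereal_inf [set (I_part tau X P)%:E | P in projection_partition M].

(* The infimum of the empty set is +oo. *)
Definition generator_invariant M (tau : (H -> H) -> R[i]) : \bar R :=
  ereal_inf [set I_set M tau X | X in
    [set X | [/\ finite_set X, X `<=` M & Wstar X = M]]].

Definition singly_generated M := exists2 x, M x & Wstar [set x] = M.

End operators.

(* Main.v *)
Require Import Defs.
From HB Require Import structures.
From mathcomp Require Import all_boot all_order all_algebra.
From mathcomp Require Import complex.
From mathcomp Require Import all_classical all_reals all_analysis.

(* Let M be a separable II_1 factor and suppose that every corner pMp is singly
   generated. Given d > 0, split 1 into projections p_1, ..., p_n of M of trace at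
   most d; let x_i generate p_i M p_i and pick nonzero elements a_i of p_i M p_1.
   As p_i M p_i is a factor, the ideal generated by a_i a_i^* in it is everything,
   so any von Neumann algebra containing the x_i and the a_i contains each
   p_i M p_j, hence M. With respect to the partition {p_i}, x_i and a_i each live in
   a single block, so I(X; P) <= sum tau(p_i)^2 + sum tau(p_i) tau(p_1) <= 2d.
   Hence G(M) = 0; so if G(M) > 0, some corner of M is not singly generated.
   Spectral projections are replaced by two monotone limits: 1 - (1 - a)^n converges
   to the range projection of a, and a quadratic iteration gives |t|, so that a
   nonscalar self-adjoint t yields zero divisors |t - l| + (t - l), |t - l| - (t - l). *)

Set Implicit Arguments.
Unset Strict Implicit.
Unset Printing Implicit Defensive.

Import Order.TTheory GRing.Theory Num.Theory.
Import numFieldNormedType.Exports.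

Local Open Scope classical_set_scope.
Local Open Scope ring_scope.
Local Open Scope complex_scope.

(** * Bounded operators with an adjoint *)

(** A corner has to be presented as an algebra on a Hilbert space of its own, the range of [p], and
    membership in [M] is transferred to it through extension by zero. Since [Wstar] is a smallest
    von Neumann algebra, generation is proved by taking an arbitrary von Neumann algebra [L] that
    contains the generators. The obstacle is that [L] is not known in advance to contain the
    identity or any p_i; p_i M p_i is reached by pulling [L] back to the corner, where the
    hypothesis on x_i applies. The faithful normal trace replaces transfinite exhaustion: maximal
    projections are found along sequences whose traces approach suprema. The shape of the links a_i
    decides the bound: they form a single column, of weight tau(p_1) <= d, and still connect all
    blocks, whereas one link for every pair of blocks would cost as much as 1. *)

Section inner_product.
Context {R : realType} {H : hilbertSpace R}.
Implicit Types (u v w : H) (a : R[i]).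
Local Notation "''[' u , v ]" := (@inner R H u v).

Lemma inner_conj u v : '[u, v] = Num.conj '[v, u].
Proof. by rewrite hermC expr0 mul1r. Qed.

Lemma inner_ge0 u : 0 <= '[u, u].
Proof. exact: dnorm_ge0. Qed.

Lemma inner0_eq0 u : '[u, u] = 0 -> u = 0.
Proof. by move=> /eqP; rewrite dnorm_eq0 => /eqP. Qed.

Lemma innerDl u v w : '[u + v, w] = '[u, w] + '[v, w].
Proof. exact: linearDl. Qed.

Lemma innerDr u v w : '[u, v + w] = '[u, v] + '[u, w].
Proof. exact: linearDr. Qed.

Lemma innerBl u v w : '[u - v, w] = '[u, w] - '[v, w].
Proof. exact: linearBl. Qed.

Lemma innerBr u v w : '[u, v - w] = '[u, v] - '[u, w].
Proof. exact: linearBr. Qed.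

Lemma innerZl a u w : '[a *: u, w] = a * '[u, w].
Proof. exact: linearZl_LR. Qed.

Lemma innerZr a u w : '[w, a *: u] = Num.conj a * '[w, u].
Proof. exact: (linearZr_LR (@inner R H)). Qed.

Lemma inner_inj u v : (forall w, '[u, w] = '[v, w]) -> u = v.
Proof.
by move=> h; apply/eqP; rewrite -subr_eq0; apply/eqP/inner0_eq0; rewrite innerBl h subrr.
Qed.

Lemma cauchy_schwarz u v : `|'[u, v]| <= `|u| * `|v|.
Proof.
have [->|v0] := eqVneq v 0; first by rewrite linear0r normr0 normr0 mulr0.
have vv : 0 < '[v, v] by rewrite dnorm_gt0.
set c := '[u, v] / '[v, v].
have cc : Num.conj c * '[v, v] = '[v, u].
  rewrite (inner_conj v v) -rmorphM/= (inner_conj v u); congr Num.conj.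
  by rewrite /c mulfVK ?gt_eqF.
have := inner_ge0 (u - c *: v).
rewrite innerBl innerZl (innerBr v) (innerZr _ v) cc subrr mulr0 subr0.
rewrite innerBr innerZr subr_ge0 => h.
have {h} : `|'[u, v]| ^+ 2 <= (`|u| * `|v|) ^+ 2.
  rewrite exprMn -!inner_norm normCK -(inner_conj v u) -cc.
  by rewrite mulrCA mulrA ler_pM2r.
by rewrite ler_sqr ?nnegrE ?mulr_ge0.
Qed.

End inner_product.

Section bounded.
Context {R : realType} {H : hilbertSpace R}.
Implicit Types (S T : H -> H) (u v : H).
Local Notation "''[' u , v ]" := (@inner R H u v).

(** The adjoint is part of the requirement: a von Neumann algebra supplies one for each of its
    members, and a strong limit of self-adjoint operators is its own adjoint. *)
Definition adjointable T :=
  bounded_operator T /\ exists S, bounded_operator S /\ is_adjoint T S.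

Lemma bounded_ge0 T : bounded_operator T ->
  exists2 k : R[i], 0 <= k & forall u, `|T u| <= k * `|u|.
Proof.
move=> [_ [k hk]]; exists `|k| => // u.
apply: (le_trans (hk u)); have h : 0 <= k * `|u| by apply: le_trans (hk u).
by rewrite -(ger0_norm h) normrM normr_id.
Qed.

Lemma bounded_operator_comb (a : R[i]) S T :
  bounded_operator S -> bounded_operator T -> bounded_operator (a *: S + T).
Proof.
move=> bS bT; have [k k0 hk] := bounded_ge0 bS; have [l l0 hl] := bounded_ge0 bT.
case: bS bT => lS _ [lT _]; split.
  move=> c u v; rewrite /= ?fctE lS lT !scalerDr !scalerA (mulrC a c).
  by rewrite addrACA.
exists (`|a| * k + l) => u; rewrite ?fctE mulrDl.
apply: (le_trans (ler_normD _ _)); apply: lerD => //.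
by rewrite normrZ -mulrA ler_wpM2l.
Qed.

Lemma bounded_operator_comp S T :
  bounded_operator S -> bounded_operator T -> bounded_operator (S \o T).
Proof.
move=> bS bT; have [k k0 hk] := bounded_ge0 bS; have [l l0 hl] := bounded_ge0 bT.
case: bS bT => lS _ [lT _]; split; first by move=> c u v; rewrite /= lT lS.
exists (k * l) => u; rewrite /= -mulrA.
by apply: (le_trans (hk _)); rewrite ler_wpM2l.
Qed.

Lemma bounded_operator_id : bounded_operator (idfun : H -> H).
Proof. by split => //; exists 1 => u; rewrite mul1r. Qed.

Lemma bounded_operator0 : bounded_operator (0 : H -> H).
Proof.
split; first by move=> c u v; rewrite ?fctE scaler0 addr0.
by exists 0 => u; rewrite ?fctE normr0 mul0r.
Qed.

Lemma adjoint_comb (a : R[i]) S T S' T' : is_adjoint S S' -> is_adjoint T T' ->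
  is_adjoint (a *: S + T) (Num.conj a *: S' + T').
Proof.
move=> hS hT u v; rewrite ?fctE innerDl innerDr innerZl innerZr hS hT.
by rewrite conjCK.
Qed.

Lemma is_adjoint_sym S T : is_adjoint S T -> is_adjoint T S.
Proof. by move=> h u v; rewrite inner_conj -h -inner_conj. Qed.

Lemma adjointable_comb (a : R[i]) S T :
  adjointable S -> adjointable T -> adjointable (a *: S + T).
Proof.
move=> [bS [S' [bS' h]]] [bT [T' [bT' h']]].
split; first exact: bounded_operator_comb.
by exists (Num.conj a *: S' + T'); split;
  [exact: bounded_operator_comb|exact: adjoint_comb].
Qed.

Lemma adjointable_comp S T :
  adjointable S -> adjointable T -> adjointable (S \o T).
Proof.
move=> [bS [S' [bS' h]]] [bT [T' [bT' h']]].
split; first exact: bounded_operator_comp.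
exists (T' \o S'); split; first exact: bounded_operator_comp.
by move=> u v; rewrite /= h h'.
Qed.

Lemma adjointable_id : adjointable (idfun : H -> H).
Proof.
by split; [|exists idfun; split => //]; exact: bounded_operator_id.
Qed.

Lemma adjointable0 : adjointable (0 : H -> H).
Proof.
split; [|exists 0; split]; [exact: bounded_operator0..|].
by move=> u v; rewrite ?fctE linear0l linear0r.
Qed.

End bounded.

(** Bundling turns operator identities into ring computations. The ring structure is a possibly
    trivial one, since the space may be zero. *)
Record bop (R : realType) (H : hilbertSpace R) :=
  Bop { bop_fun :> H -> H; bopP : adjointable bop_fun }.

Section bop_ring.
Context {R : realType} {H : hilbertSpace R}.
Local Notation B := (bop H).
Implicit Types (x y z : B) (u v w : H) (a b : R[i]).

HB.instance Definition _ := gen_eqMixin B.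
HB.instance Definition _ := gen_choiceMixin B.

Lemma bop_ext x y : x =1 y -> x = y.
Proof.
case: x y => [x hx] [y hy] /= /funext e; move: hx hy; rewrite {}e => hx hy.
by rewrite (Prop_irrelevance hx hy).
Qed.

Fact bop_linear x : linear x. Proof. by case: x => x [[]]. Qed.
HB.instance Definition _ x := GRing.isLinear.Build _ _ _ _ x (@bop_linear x).

Definition bop_comb a x y : B := Bop (adjointable_comb a (bopP x) (bopP y)).
Definition bop_zero : B := Bop adjointable0.
Definition bop_one : B := Bop adjointable_id.
Definition bop_mul x y : B := Bop (adjointable_comp (bopP x) (bopP y)).

Fact bop_addrA : associative (bop_comb 1).
Proof. by move=> x y z; apply: bop_ext => u; rewrite /= ?fctE !scale1r addrA. Qed.
Fact bop_addrC : commutative (bop_comb 1).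
Proof. by move=> x y; apply: bop_ext => u; rewrite /= ?fctE !scale1r addrC. Qed.
Fact bop_add0r : left_id bop_zero (bop_comb 1).
Proof. by move=> x; apply: bop_ext => u; rewrite /= ?fctE scaler0 add0r. Qed.
Fact bop_addNr : left_inverse bop_zero (fun x => bop_comb (- 1) x bop_zero) (bop_comb 1).
Proof.
move=> x; apply: bop_ext => u.
by rewrite /= ?fctE addr0 scale1r scaleN1r addNr.
Qed.
HB.instance Definition _ := GRing.isZmodule.Build B
  bop_addrA bop_addrC bop_add0r bop_addNr.

Lemma bopD x y u : (x + y) u = x u + y u.
Proof. by rewrite /GRing.add/= ?fctE scale1r. Qed.
Lemma bop0 u : (0 : B) u = 0. Proof. by []. Qed.
Lemma bopN x u : (- x) u = - x u.
Proof. by rewrite {1}/GRing.opp/= ?fctE addr0 scaleN1r. Qed.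
Lemma bopB x y u : (x - y) u = x u - y u.
Proof. by rewrite bopD bopN. Qed.

Fact bop_mulA : associative bop_mul.
Proof. by move=> x y z; apply: bop_ext. Qed.
Fact bop_mul1 : left_id bop_one bop_mul.
Proof. by move=> x; apply: bop_ext. Qed.
Fact bop_mulr1 : right_id bop_one bop_mul.
Proof. by move=> x; apply: bop_ext. Qed.
Fact bop_mulDl : left_distributive bop_mul +%R.
Proof. by move=> x y z; apply: bop_ext => u; rewrite bopD; exact: bopD. Qed.
Fact bop_mulDr : right_distributive bop_mul +%R.
Proof.
move=> x y z; apply: bop_ext => u; rewrite bopD.
change (x ((y + z) u) = x (y u) + x (z u)).
by rewrite bopD raddfD.
Qed.
HB.instance Definition _ := GRing.Zmodule_isPzRing.Build B
  bop_mulA bop_mul1 bop_mulr1 bop_mulDl bop_mulDr.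

Definition bop_scale a x : B := bop_comb a x 0.
Fact bop_scaleE a x u : bop_scale a x u = a *: x u.
Proof. by rewrite /= ?fctE addr0. Qed.
Fact bop_scalerA a b x : bop_scale a (bop_scale b x) = bop_scale (a * b) x.
Proof. by apply: bop_ext => u; rewrite !bop_scaleE scalerA. Qed.
Fact bop_scale1r : left_id 1 bop_scale.
Proof. by move=> x; apply: bop_ext => u; rewrite bop_scaleE scale1r. Qed.
Fact bop_scalerDr : right_distributive bop_scale +%R.
Proof.
by move=> a x y; apply: bop_ext => u; rewrite bopD !bop_scaleE bopD scalerDr.
Qed.
Fact bop_scalerDl x : {morph bop_scale^~ x : a b / a + b}.
Proof. by move=> a b; apply: bop_ext => u; rewrite bopD !bop_scaleE scalerDl. Qed.
HB.instance Definition _ := GRing.Zmodule_isLmodule.Build R[i] B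
  bop_scalerA bop_scale1r bop_scalerDr bop_scalerDl.

Lemma bopZ a x u : (a *: x) u = a *: x u. Proof. exact: bop_scaleE. Qed.
Lemma bop1 u : (1 : B) u = u. Proof. by []. Qed.
Lemma bopM x y u : (x * y) u = x (y u). Proof. by []. Qed.

Lemma bopZl a x y : (a *: x) * y = a *: (x * y).
Proof. by apply: bop_ext => u; rewrite bopM !bopZ bopM. Qed.

Lemma bopZr a x y : x * (a *: y) = a *: (x * y).
Proof. by apply: bop_ext => u; rewrite bopM !bopZ bopM linearZ. Qed.

Lemma bop_adjP x : exists y : B, is_adjoint x y.
Proof.
case: x => x [bx [y [b_y h]]].
by exists (@Bop _ _ y (conj b_y (ex_intro _ x (conj bx (is_adjoint_sym h))))).
Qed.

Definition adj x : B := sval (cid (bop_adjP x)).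
Local Notation "''[' u , v ]" := (@inner R H u v).

Lemma adjE x u v : '[x u, v] = '[u, adj x v].
Proof. by rewrite /adj; case: cid => y /= ->. Qed.

Lemma adjEr x u v : '[u, x v] = '[adj x u, v].
Proof. by rewrite inner_conj adjE -inner_conj. Qed.

Lemma adj_uniq x y : is_adjoint x y -> adj x = y.
Proof.
move=> h; apply: bop_ext => u; apply: inner_inj => w.
by rewrite inner_conj -adjE h -inner_conj.
Qed.

Lemma adjK : involutive adj.
Proof. by move=> x; apply: adj_uniq => u v; rewrite adjEr adjE. Qed.

Lemma adjD x y : adj (x + y) = adj x + adj y.
Proof.
by apply: adj_uniq => u v; rewrite !bopD innerDl innerDr !adjE.
Qed.

Lemma adjM x y : adj (x * y) = adj y * adj x.
Proof. by apply: adj_uniq => u v; rewrite !bopM !adjE. Qed.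

Lemma adjZ a x : adj (a *: x) = Num.conj a *: adj x.
Proof.
by apply: adj_uniq => u v; rewrite !bopZ innerZl innerZr !adjE conjCK.
Qed.

Lemma adj1 : adj 1 = 1.
Proof. exact: adj_uniq. Qed.

Lemma adj0 : adj 0 = 0.
Proof. by rewrite -(scale0r (1 : B)) adjZ conjC0 !scale0r. Qed.

Lemma adjN x : adj (- x) = - adj x.
Proof. by rewrite -scaleN1r adjZ rmorphN1 scaleN1r. Qed.

Lemma adjB x y : adj (x - y) = adj x - adj y.
Proof. by rewrite adjD adjN. Qed.

Lemma bop_bound x : exists2 k : R[i], 0 < k & forall u, `|x u| <= k * `|u|.
Proof.
have [k k0 hk] := bounded_ge0 (bopP x).1; exists (k + 1); first exact: ltr_wpDl.
by move=> u; apply: (le_trans (hk u)); rewrite ler_wpM2r // lerDl.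
Qed.

End bop_ring.

(** * Positivity and strong limits *)

Section positivity.
Context {R : realType} {H : hilbertSpace R}.
Local Notation B := (bop H).
Local Notation "''[' u , v ]" := (@inner R H u v).
Implicit Types (x y z : B) (u v w : H) (a b : R[i]).

Definition pos x := adj x = x /\ forall u, 0 <= '[x u, u].

Lemma posD x y : pos x -> pos y -> pos (x + y).
Proof.
move=> [ax px] [ay py]; split; first by rewrite adjD ax ay.
by move=> u; rewrite bopD innerDl addr_ge0.
Qed.

Lemma pos0 : pos 0.
Proof. by split; [exact: adj0|move=> u; rewrite bop0 linear0l]. Qed.

Lemma pos_adjM x : pos (adj x * x).
Proof.
split; first by rewrite adjM adjK.
by move=> u; rewrite bopM -adjEr inner_ge0.
Qed.

Lemma pos1 : pos 1.
Proof. by have := pos_adjM 1; rewrite adj1 mulr1. Qed.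

Lemma posZ a x : 0 <= a -> pos x -> pos (a *: x).
Proof.
move=> a0 [ax px]; split; first by rewrite adjZ ax geC0_conj.
by move=> u; rewrite bopZ innerZl mulr_ge0.
Qed.

Lemma pos_conj x y : pos x -> pos (adj y * x * y).
Proof.
move=> [ax px]; split; first by rewrite !adjM adjK ax mulrA.
by move=> u; rewrite !bopM -adjEr.
Qed.

Lemma pos_sqr x : adj x = x -> pos (x * x).
Proof. by move=> {1}<-; exact: pos_adjM. Qed.

Lemma pos_conjsa x y : adj y = y -> pos x -> pos (y * x * y).
Proof. by move=> e px; rewrite -{1}e; exact: pos_conj. Qed.

Lemma adjM0 x : adj x * x = 0 -> x = 0.
Proof.
move=> h; apply: bop_ext => u; rewrite bop0; apply: inner0_eq0.
by rewrite adjE -bopM h linear0r.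
Qed.

(** The form of [x] vanishes identically; evaluated at [u + x u] it leaves twice the square of the
    norm of [x u]. *)
Lemma pos_anti x : pos x -> pos (- x) -> x = 0.
Proof.
move=> [ax px] [_ nx].
have x0 u : '[x u, u] = 0.
  apply/eqP; rewrite eq_le px andbT -oppr_ge0 -linearNl -bopN.
  exact: nx.
apply: bop_ext => u; apply: inner0_eq0.
have := x0 (u + x u); rewrite (raddfD x) innerDl !innerDr !x0 addr0 add0r.
rewrite [X in _ + X]adjE ax -mulr2n => h.
by apply/eqP; move/eqP: h; rewrite mulrn_eq0.
Qed.

Lemma pos_bound x : exists2 c : R[i], 0 < c & pos (c *: (1 : B) - adj x * x).
Proof.
have [k k0 hk] := bop_bound x; exists (k ^+ 2); first by rewrite exprn_gt0.
split; first by rewrite adjB adjZ adj1 adjM adjK geC0_conj // exprn_ge0 // ltW.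
move=> u; rewrite bopB bopZ bopM bop1 innerBl innerZl -adjEr subr_ge0.
by rewrite !inner_norm -exprMn ler_sqr ?nnegrE // mulr_ge0 // ltW.
Qed.

(* [x - x^2 = x (1 - x) x + (1 - x) x (1 - x)] *)
Lemma pos_subsqr x : pos x -> pos (1 - x) -> pos (x - x * x).
Proof.
move=> px p1x; have [ax _] := px; have [a1x _] := p1x.
have e : (1 - x) * x = x * (1 - x) by rewrite mulrBl mulrBr mul1r mulr1.
have -> : x - x * x = x * (1 - x) * x + (1 - x) * x * (1 - x).
  rewrite -(mulrA x) -(mulrA (1 - x)) e -mulrDl.
  have -> : x + (1 - x) = 1 by rewrite addrCA subrr addr0.
  rewrite mul1r.
  by rewrite mulrBr mulr1.
by apply: posD; exact: pos_conjsa.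
Qed.

(** This turns control of the quadratic form into control in norm, and so upgrades convergence of
    forms to strong convergence. *)
Lemma contraction_sqr x u : pos x -> pos (1 - x) -> `|x u| ^+ 2 <= '[x u, u].
Proof.
move=> px p1x; have [_ /(_ u)] := pos_subsqr px p1x; have [ax _] := px.
by rewrite bopB innerBl bopM [X in _ - X]adjE ax subr_ge0 inner_norm.
Qed.

Lemma contraction x u : pos x -> pos (1 - x) -> `|x u| <= `|u|.
Proof.
move=> px p1x; rewrite -ler_sqr ?nnegrE //.
apply: (le_trans (contraction_sqr u px p1x)).
have [_ /(_ u)] := p1x; rewrite bopB bop1 innerBl subr_ge0.
by rewrite inner_norm.
Qed.

End positivity.

Section strong_limit.
Context {R : realType} {H : hilbertSpace R}.
Local Notation B := (bop H).
Local Notation "''[' u , v ]" := (@inner R H u v).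
Implicit Types (x y : nat -> B) (a b c : B) (u v w : H).

Definition slim x a := forall u, (x n u) @[n --> \oo] --> a u.

Lemma slimP x a : slim x a <->
  forall u (e : R[i]), 0 < e -> \forall n \near \oo, `|a u - x n u| < e.
Proof.
split=> h u; last by apply/cvgrPdist_lt => e e0; exact: h.
by move=> e e0; have /cvgrPdist_lt /(_ e e0) := h u.
Qed.

Lemma slim_uniq x a b : slim x a -> slim x b -> a = b.
Proof.
move=> ha hb; apply: bop_ext => u.
exact: (cvg_unique _ (ha u) (hb u)).
Qed.

Lemma slim_cst a : slim (fun=> a) a.
Proof. by move=> u; exact: cvg_cst. Qed.

Lemma slimD x y a b : slim x a -> slim y b -> slim (fun n => x n + y n) (a + b).
Proof.
move=> ha hb u; rewrite bopD; under eq_fun do rewrite bopD.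
exact: cvgD (ha u) (hb u).
Qed.

Lemma slimZ (k : R[i]) x a : slim x a -> slim (fun n => k *: x n) (k *: a).
Proof.
move=> ha u; rewrite bopZ; under eq_fun do rewrite bopZ.
exact: cvgZ (cvg_cst _) (ha u).
Qed.

Lemma slimB x y a b : slim x a -> slim y b -> slim (fun n => x n - y n) (a - b).
Proof.
move=> ha hb u; rewrite bopB; under eq_fun do rewrite bopB.
exact: cvgB (ha u) (hb u).
Qed.

Lemma lipschitz_cvg (V W : normedModType R[i]) (f : V -> W) (k : R[i])
    (s : nat -> V) (l : V) : 0 < k -> (forall x y : V, `|f x - f y| <= k * `|x - y|) ->
  s n @[n --> \oo] --> l -> f (s n) @[n --> \oo] --> f l.
Proof.
move=> k0 hf /cvgrPdist_lt hs; apply/cvgrPdist_lt => e e0.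
have [N _ hN] := hs (e / k) (divr_gt0 e0 k0); exists N => // n /hN /= h.
by apply: (le_lt_trans (hf _ _)); rewrite mulrC -ltr_pdivlMr.
Qed.

Lemma cvg_inner (s : nat -> H) u w : s n @[n --> \oo] --> u ->
  forall e : R[i], 0 < e -> \forall n \near \oo, `|'[u, w] - '[s n, w]| < e.
Proof.
move=> hs e e0.
have : ('[s n, w] : R[i]^o) @[n --> \oo] --> ('[u, w] : R[i]^o).
  apply: (@lipschitz_cvg _ (R[i]^o : normedModType R[i]) (fun u => '[u, w]) (`|w| + 1)) hs.
    exact: ltr_wpDl.
  move=> x y; rewrite -innerBl; apply: (le_trans (cauchy_schwarz _ _)).
  by rewrite mulrC ler_wpM2r // lerDl.
by move=> /cvgrPdist_lt /(_ e e0).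
Qed.

Lemma slimMl x a c : slim x a -> slim (fun n => c * x n) (c * a).
Proof.
move=> ha u; rewrite bopM.
have [k k0 hk] := bop_bound c.
apply: (lipschitz_cvg k0 _ (ha u)) => v w.
by have := hk (v - w); rewrite (linearB c).
Qed.

Lemma slimMr x a c : slim x a -> slim (fun n => x n * c) (a * c).
Proof. by move=> ha u; exact: (ha (c u)). Qed.

Lemma slimS x a : slim x a -> slim (fun n => x n.+1) a.
Proof. by move=> ha u; have := ha u; rewrite -(cvg_shiftS (x ^~ u)). Qed.

End strong_limit.

Section complex_facts.
Context {R : realType}.
Implicit Types (z : R[i]) (r : R).

Lemma complex_ge0 z : 0 <= z -> z = (complex.Re z)%:C.
Proof. by case: z => a b; rewrite lecE /= => /andP[/eqP -> _]. Qed.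

Lemma Re_mono z z' : z <= z' -> complex.Re z <= complex.Re z'.
Proof. by rewrite lecE => /andP[]. Qed.

Lemma Re_gt0 z : 0 < z -> 0 < complex.Re z.
Proof. by rewrite ltcE => /andP[]. Qed.

Lemma ReD z z' : complex.Re (z + z') = complex.Re z + complex.Re z'.
Proof. by case: z; case: z'. Qed.

Lemma ReN z : complex.Re (- z) = - complex.Re z.
Proof. by case: z. Qed.

Lemma ReB z z' : complex.Re (z - z') = complex.Re z - complex.Re z'.
Proof. by rewrite ReD ReN. Qed.

End complex_facts.

Section strong_limit_facts.
Context {R : realType} {H : hilbertSpace R}.
Local Notation B := (bop H).
Local Notation "''[' u , v ]" := (@inner R H u v).
Implicit Types (x : nat -> B) (a : B).

(** Here [y] is a bare function: the lemma also serves to build the limit, before it is known to be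
    a [bop]. *)
Lemma cvg_symmetric x (y : H -> H) : (forall n, adj (x n) = x n) ->
  (forall u, x n u @[n --> \oo] --> y u) -> is_adjoint y y.
Proof.
move=> x_sa yl u v.
suff h (e : R[i]) : 0 < e -> `|'[y u, v] - '[u, y v]| < e + e.
  apply/eqP; rewrite -subr_eq0 -normr_eq0; apply/negPn/negP => h0.
  have p0 : 0 < `|'[y u, v] - '[u, y v]| by rewrite lt0r h0 normr_ge0.
  by have := h _ (divr_gt0 p0 (ltr0Sn _ 1)); rewrite -splitr ltxx.
move=> e0.
have [N _ hN] := cvg_inner v (yl u) e0; have [M _ hM] := cvg_inner u (yl v) e0.
have /= {}hN := hN (maxn N M) (leq_maxl _ _).
have /= {}hM := hM (maxn N M) (leq_maxr _ _).
rewrite (inner_conj u (y v)).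
rewrite -(subrK '[x (maxn N M) u, v] '[y u, v]) -addrA.
apply: (le_lt_trans (ler_normD _ _)); apply: ltrD => //.
rewrite distrC [X in _ - X]adjE x_sa (inner_conj u (x _ v)) -rmorphB norm_conjC.
exact: hM.
Qed.

Lemma slim_sa x a : (forall n, adj (x n) = x n) -> slim x a -> adj a = a.
Proof. by move=> sa h; apply: adj_uniq; exact: (cvg_symmetric sa h). Qed.

Lemma slim_pos x a : (forall n, pos (x n)) -> slim x a -> pos a.
Proof.
move=> px h; split; first by apply: slim_sa h => n; have [] := px n.
move=> u; have ar : '[a u, u] \is Num.real.
  apply/CrealP; rewrite -inner_conj adjE (slim_sa _ h) // => n.
  by have [] := px n.
rewrite real_leNgt ?real0 //; apply/negP => n0.
have e0 : 0 < - '[a u, u] by rewrite oppr_gt0.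
have [N _ /(_ N (leqnn N)) /=] := cvg_inner u (h u) e0.
have [_ /(_ u) p] := px N.
rewrite ltr0_norm ?subr_lt0 ?(lt_le_trans n0) // opprB.
by rewrite gtrDr => /lt_geF; rewrite p.
Qed.

Lemma slim_shift k x a : slim x a -> slim (fun n => x (n + k)%N) a.
Proof. by move=> h u; have := h u; rewrite -(cvg_shiftn k). Qed.

End strong_limit_facts.

(** * Bounded monotone sequences converge strongly *)

Section monotone_limit.
Context {R : realType} {H : hilbertSpace R}.
Local Notation B := (bop H).
Local Notation "''[' u , v ]" := (@inner R H u v).
Variable x : nat -> B.
Hypothesis x_sa : forall n, adj (x n) = x n.
Hypothesis x_mono : forall n m, (n <= m)%N -> pos (x m - x n).
Hypothesis x_bnd : forall n m, (n <= m)%N -> pos (1 - (x m - x n)).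

(** The numbers ['[x n u, u]] increase and are bounded, and [contraction_sqr], applied to the
    differences [x n - x N], makes the vectors [x n u] a Cauchy sequence. *)
Fact mono_cvg u : cvg (x n u @[n --> \oo]).
Proof.
pose a n := complex.Re '[x n u, u].
have amono n m : (n <= m)%N -> a n <= a m.
  move=> nm; have [_ /(_ u) /Re_mono] := x_mono nm.
  by rewrite bopB innerBl ReB subr_ge0.
have abnd n : a n <= a 0%N + complex.Re '[u, u].
  have [_ /(_ u) /Re_mono] := x_bnd (leq0n n).
  by rewrite !bopB bop1 !innerBl !ReB subr_ge0 lerBlDl.
apply/cauchy_cvgP/cauchy_exP => e e0.
have e0' : 0 < complex.Re e ^+ 2 by rewrite exprn_gt0 // Re_gt0.
have supa : has_sup (range a).
  split; first by exists (a 0%N), 0%N.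
  by exists (a 0%N + complex.Re '[u, u]) => _ [n _ <-].
have [_ [N _ <-] hN] := sup_adherent e0' supa.
exists (x N u); exists N => // n /= Nn; rewrite -ball_normE /ball_/=.
rewrite distrC -ltr_sqr ?nnegrE ?(ltW e0) // -bopB.
apply: (le_lt_trans (contraction_sqr u (x_mono Nn) (x_bnd Nn))).
have [_ /(_ u) /complex_ge0 ->] := x_mono Nn.
rewrite bopB innerBl ReB (complex_ge0 (ltW e0)) -rmorphXn ltcR ltrBlDr.
rewrite addrC -ltrBlDr; apply: le_lt_trans hN.
rewrite lerD2r; apply: ub_le_sup; [by case: supa|by exists n].
Qed.

Let y u := lim (x n u @[n --> \oo]).

Let y_adjointable : adjointable y.
Proof.
have yl u : x n u @[n --> \oo] --> y u := @mono_cvg u.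
have ylin : linear y.
  move=> a u v.
  have h : (a *: x n u + x n v) @[n --> \oo] --> a *: y u + y v.
    by apply: cvgD; [apply: cvgZ; [exact: cvg_cst|]|].
  have e : (fun n => a *: x n u + x n v) = (fun n => x n (a *: u + v)).
    by apply/funext => n; rewrite linearP.
  by rewrite e in h; exact: (cvg_unique _ (yl _) h).
have yadj : is_adjoint y y by exact: cvg_symmetric yl.
have [k k0 hk] := bop_bound (x 0%N).
suff yb : bounded_operator y by split => //; exists y.
(* For an index [N] depending on [u], the three terms bound [x N u - x 0 u], [x 0 u] and
   [y u - x N u] by multiples of the norm of [u]. *)
split => //; exists (1 + k + 1) => u.
have [->|u0] := eqVneq u 0.
  have -> : y 0 = 0 by have := ylin (-1) 0 0; rewrite scaler0 addr0 scaleN1r addNr.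
  by rewrite normr0 mulr0.
have /cvgrPdist_lt /(_ `|u|) := yl u; rewrite normr_gt0 => /(_ u0).
move=> [N _ /(_ N (leqnn N)) /= hN].
rewrite -(subrK (x N u) (y u)) addrC [in leRHS]mulrDl mul1r.
apply: (le_trans (ler_normD _ _)); apply: lerD; last exact: ltW.
rewrite -(subrK (x 0%N u) (x N u)) mulrDl mul1r.
apply: (le_trans (ler_normD _ _)); apply: lerD => //.
by rewrite -bopB; apply: contraction; [exact: x_mono|exact: x_bnd].
Qed.

Lemma mono_slim : exists z : B, [/\ slim x z, adj z = z & forall n, pos (z - x n)].
Proof.
pose z := Bop y_adjointable.
have hz : slim x z by move=> u; exact: (@mono_cvg u).
have az : adj z = z by exact: slim_sa hz.
exists z; split => // n; apply: (@slim_pos _ _ (fun m => x (m + n)%N - x n)).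
  by move=> m; apply: x_mono; rewrite leq_addl.
apply: slimB; last exact: slim_cst.
exact: slim_shift.
Qed.

End monotone_limit.

(** * Range projections and square roots *)

Section projections.
Context {R : realType} {H : hilbertSpace R}.
Local Notation B := (bop H).
Implicit Types (a b c d x y z p q r s : B) (N : set B).

(* No identity is required; a von Neumann algebra is closed under strong limits of
   sequences, which is all the closure needed below. *)
Record salg N : Prop := Salg {
  salg0 : N 0;
  salg_comb : forall (k : R[i]) x y, N x -> N y -> N (k *: x + y);
  salgM : forall x y, N x -> N y -> N (x * y);
  salg_adj : forall x, N x -> N (adj x);
  salg_lim : forall (f : nat -> B) x, (forall n, N (f n)) -> slim f x -> N x
}.

Lemma salgD N x y : salg N -> N x -> N y -> N (x + y).
Proof. by move=> hN Nx Ny; rewrite -(scale1r x); exact: (salg_comb hN). Qed.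

Lemma salgZ N (k : R[i]) x : salg N -> N x -> N (k *: x).
Proof.
by move=> hN Nx; rewrite -(addr0 (k *: x)); apply: (salg_comb hN) => //; exact: salg0.
Qed.

Lemma salgB N x y : salg N -> N x -> N y -> N (x - y).
Proof.
by move=> hN Nx Ny; apply: salgD => //; rewrite -scaleN1r; exact: salgZ.
Qed.

Definition proj p := adj p = p /\ p * p = p.

Lemma proj0 : proj 0.
Proof. by split; rewrite ?adj0 ?mulr0. Qed.

Lemma proj1 : proj 1.
Proof. by split; rewrite ?adj1 ?mulr1. Qed.

Lemma proj_pos p : proj p -> pos p.
Proof. by move=> [ap pp]; rewrite -pp -{1}ap; exact: pos_adjM. Qed.

Lemma projC p : proj p -> proj (1 - p).
Proof.
move=> [ap pp]; split; first by rewrite adjB adj1 ap.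
by rewrite mulrBl mul1r mulrBr mulr1 pp subrr subr0.
Qed.

(** The induction goes in steps of two: conjugation by [b] preserves positivity, while a product of
    positive operators need not be positive. *)
Lemma pos_exp b n : pos b -> pos (b ^+ n).
Proof.
move=> pb; have [ab _] := pb.
elim/ltn_ind: n => -[_|[_|n IH]]; rewrite ?expr0 ?expr1 //; first exact: pos1.
by rewrite exprS exprSr mulrA; apply: pos_conjsa => //; exact: IH.
Qed.

Lemma pos_expS b n : pos b -> pos (1 - b) -> pos (b ^+ n - b ^+ n.+1).
Proof.
move=> pb p1b; have [ab _] := pb.
elim/ltn_ind: n => -[_|[_|n IH]]; rewrite ?expr0 ?expr1 //.
  by rewrite expr2; exact: pos_subsqr.
have -> : b ^+ n.+2 - b ^+ n.+3 = b * (b ^+ n - b ^+ n.+1) * b.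
  by rewrite mulrBr mulrBl -!exprS -!exprSr.
by apply: pos_conjsa => //; exact: IH.
Qed.

Lemma pos_expB b n m : pos b -> pos (1 - b) -> (n <= m)%N -> pos (b ^+ n - b ^+ m).
Proof.
move=> pb p1b /subnK <-; elim: (m - n)%N => [|k IH].
  by rewrite subrr; exact: pos0.
have -> : b ^+ n - b ^+ (k.+1 + n) =
    (b ^+ n - b ^+ (k + n)) + (b ^+ (k + n) - b ^+ (k + n).+1).
  by rewrite addrA subrK.
by apply: posD => //; exact: pos_expS.
Qed.

Lemma slimMl_eq (f : nat -> B) a c d :
  (forall n, c * f n = d) -> slim f a -> c * a = d.
Proof.
move=> h fa; apply: (@slim_uniq _ _ (fun n => c * f n)); first exact: slimMl.
by rewrite (_ : (fun n => _) = fun=> d); [exact: slim_cst|exact/funext].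
Qed.

Lemma slimMr_eq (f : nat -> B) a c d :
  (forall n, f n * c = d) -> slim f a -> a * c = d.
Proof.
move=> h fa; apply: (@slim_uniq _ _ (fun n => f n * c)); first exact: slimMr.
by rewrite (_ : (fun n => _) = fun=> d); [exact: slim_cst|exact/funext].
Qed.

Lemma slim_comm (f : nat -> B) a c : (forall n, c * f n = f n * c) ->
  slim f a -> c * a = a * c.
Proof.
move=> h fa; apply: (@slim_uniq _ _ (fun n => c * f n)); first exact: slimMl.
by rewrite (_ : (fun n => _) = fun n => f n * c); [exact: slimMr|exact/funext].
Qed.

(** The sequence [1 - b ^+ n] increases with differences between 0 and 1, hence converges. Passing
    to the limit in [b ^+ n.+1 = b * b ^+ n] gives [b * e = e], so [b ^+ n * e = e] for all [n] and
    [e * e = e]: [e] projects onto the vectors fixed by [b]. *)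
Lemma slim_exp b : pos b -> pos (1 - b) ->
  exists e, [/\ slim (fun n => b ^+ n) e, proj e, b * e = e & e * b = e].
Proof.
move=> pb p1b.
have d n m : 1 - b ^+ m - (1 - b ^+ n) = b ^+ n - b ^+ m.
  by rewrite opprB addrC addrA subrK.
have [|n m nm|n m nm|y [hy ay _]] := @mono_slim _ _ (fun n => 1 - b ^+ n).
- by move=> n; rewrite adjB adj1; have [-> _] := pos_exp n pb.
- by rewrite d; exact: pos_expB.
- rewrite d opprB addrA addrAC -{1}(expr0 b).
  by apply: posD; [exact: pos_expB|exact: pos_exp].
have he : slim (fun n => b ^+ n) (1 - y).
  have := slimB (@slim_cst R H 1) hy; congr slim; apply/funext => n.
  by rewrite opprB addrC subrK.
exists (1 - y).
have be : b * (1 - y) = 1 - y.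
  apply: slim_uniq (slimS he); rewrite (_ : (fun n => _) = fun n => b * b ^+ n).
    exact: slimMl.
  by apply/funext => n; rewrite exprS.
have eb : (1 - y) * b = 1 - y.
  apply: slim_uniq (slimS he); rewrite (_ : (fun n => _) = fun n => b ^+ n * b).
    exact: slimMr.
  by apply/funext => n; rewrite exprSr.
split => //; split; first by rewrite adjB adj1 ay.
have bne n : b ^+ n * (1 - y) = 1 - y.
  by elim: n => [|n IH]; rewrite ?expr0 ?mul1r // exprS -mulrA IH.
exact: slimMr_eq bne he.
Qed.

Lemma pos_ub a : adj a = a -> exists2 k : R[i], 0 < k & pos (1 - k *: a).
Proof.
move=> aa; have [c c0 hc] := pos_bound a; rewrite aa in hc.
have c1 : 0 < 1 + c by rewrite addr_gt0.
(* The constant comes from (1 - a)^2 + (c - a^2) = (1 + c) - 2 a, a sum of two positive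
   operators. *)
exists (2 / (1 + c)); first by rewrite divr_gt0.
have -> : 1 - (2 / (1 + c)) *: a =
    (1 + c)^-1 *: ((1 - a) * (1 - a) + (c *: (1 : B) - a * a)).
  have -> : (1 - a) * (1 - a) + (c *: (1 : B) - a * a) = (1 + c) *: (1 : B) - 2 *: a.
    rewrite mulrBl mul1r mulrBr mulr1 opprB -(addrA (1 - a)).
    have -> : a * a - a + (c *: (1 : B) - a * a) = c *: (1 : B) - a.
      by rewrite addrC addrA subrK.
    by rewrite addrACA -opprD scalerDl scale1r scaler_nat mulr2n.
  rewrite scalerBr !scalerA mulVf ?gt_eqF // scale1r.
  by rewrite mulrC.
apply: posZ; first by rewrite invr_ge0 ltW.
by apply: posD => //; apply: pos_sqr; rewrite adjB adj1 aa.
Qed.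

(* [r] is the limit of [1 - (1 - k a)^n], a polynomial in [a] without constant term. *)
Lemma range_proj N a : salg N -> N a -> pos a ->
  exists r, [/\ N r, proj r, r * a = a, a * r = a &
    forall s, s * a = 0 -> s * r = 0].
Proof.
move=> hN Na pa; have [k k0 hk] := pos_ub pa.1.
set b := 1 - k *: a.
have kb : k *: a = 1 - b by rewrite /b opprB addrC subrK.
have [|e [he pe be eb]] := slim_exp hk _.
  by rewrite -/b -kb; apply: posZ => //; exact: ltW.
have hr : slim (fun n => 1 - b ^+ n) (1 - e) by apply: slimB => //; exact: slim_cst.
have kN0 : k != 0 by rewrite gt_eqF.
exists (1 - e); split.
- apply: (salg_lim hN _ hr); elim=> [|n IH].
    by rewrite expr0 subrr; exact: (salg0 hN).
  (* A recursion that does not mention the unit, which may lie outside [N]. *)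
  have -> : 1 - b ^+ n.+1 = (1 - b ^+ n) + k *: a - (1 - b ^+ n) * (k *: a).
    rewrite kb -addrA -[X in _ = _ + (X - _)]mul1r -mulrBl subKr.
    by rewrite mulrBr mulr1 -exprSr addrA subrK.
  by apply: salgB => //; [apply: salgD => //|apply: (salgM hN) => //]; exact: salgZ.
- exact: projC.
- apply: (scalerI kN0); rewrite -bopZr kb mulrBl mul1r mulrBr eb mulr1 subrr subr0.
  by [].
- apply: (scalerI kN0); rewrite -bopZl kb mulrBr mulr1 mulrBl be mul1r subrr subr0.
  by [].
move=> s sa; have sbn n : s * b ^+ n = s.
  elim: n => [|n IH]; first by rewrite expr0 mulr1.
  by rewrite exprSr mulrA IH /b mulrBr mulr1 bopZr sa scaler0 subr0.
rewrite mulrBr mulr1; apply/eqP; rewrite subr_eq0 eq_sym; apply/eqP.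
exact: slimMl_eq sbn he.
Qed.

End projections.

(** * Absolute values by a quadratic iteration *)

Section square_root.
Context {R : realType} {H : hilbertSpace R}.
Local Notation B := (bop H).
Implicit Types (a b c x y z p q r s t : B) (N : set B).

Lemma slimM (f g : nat -> B) a b : (forall n u, `|f n u| <= `|u|) ->
  slim f a -> slim g b -> slim (fun n => f n * g n) (a * b).
Proof.
move=> hf /slimP fa /slimP gb; apply/slimP => u e e0.
have e2 : 0 < e / 2 by rewrite divr_gt0.
have [N _ hN] := fa (b u) _ e2; have [M _ hM] := gb u _ e2.
exists (maxn N M) => // n /= ; rewrite geq_max => /andP[Nn Mn].
rewrite ?bopM -(subrK (f n (b u)) (a (b u))) -addrA -linearB [e]splitr.
apply: (le_lt_trans (ler_normD _ _)); apply: ltrD; first exact: hN.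
by apply: (le_lt_trans (hf _ _)); exact: hM.
Qed.

(* The operators [q(b)], for [q] a polynomial with nonnegative coefficients: when
   [b] is positive this is a cone of positive operators closed under products. *)
Inductive cone b : B -> Prop :=
| cone0 : cone b 0
| coneS (k : R[i]) n x : 0 <= k -> cone b x -> cone b (k *: b ^+ n + x).

Lemma coneD b x y : cone b x -> cone b y -> cone b (x + y).
Proof.
move=> hx hy; elim: hx => [|k n x' k0 _ IH]; first by rewrite add0r.
by rewrite -addrA; exact: coneS.
Qed.

Lemma coneZ b (k : R[i]) x : 0 <= k -> cone b x -> cone b (k *: x).
Proof.
move=> k0; elim=> [|l n x' l0 _ IH]; first by rewrite scaler0; exact: cone0.
by rewrite scalerDr scalerA; apply: coneS => //; rewrite mulr_ge0.
Qed.

Lemma cone_exp b n : cone b (b ^+ n).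
Proof.
by rewrite -(addr0 (b ^+ n)) -(scale1r (b ^+ n)); apply: coneS => //; exact: cone0.
Qed.

Lemma coneM b x y : cone b x -> cone b y -> cone b (x * y).
Proof.
move=> hx hy; elim: hx => [|k n x' k0 _ IH]; first by rewrite mul0r; exact: cone0.
rewrite mulrDl bopZl; apply: coneD => //; apply: coneZ => //.
elim: hy => [|l m y' l0 _ IHy]; first by rewrite mulr0; exact: cone0.
by rewrite mulrDr bopZr -exprD; exact: coneS.
Qed.

Lemma cone_pos b x : pos b -> cone b x -> pos x.
Proof.
move=> pb; elim=> [|k n x' k0 _ IH]; first exact: pos0.
by apply: posD => //; apply: posZ => //; exact: pos_exp.
Qed.

(** Here [s] is the absolute value of [t]. As a limit of polynomials in [t * t], it commutes with
    whatever commutes with [t]; through this clause the zero divisors built from a central element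
    of a corner commute with that corner. *)
Lemma sqrt_of_sqr N t : salg N -> N 1 -> N t -> adj t = t ->
  exists s, [/\ N s, pos s, s * s = t * t & forall c, c * t = t * c -> c * s = s * c].
Proof.
move=> hN N1 Nt at_; have [k k0] := pos_bound t; rewrite at_ => hk.
(* With [b = 1 - t^2 / k] between 0 and 1, the sequence [y (n + 1) = (b + y n ^ 2) / 2]
   increases to [Y] with [(1 - Y)^2 = 1 - b]. *)
pose b := 1 - k^-1 *: (t * t).
have kN0 : k != 0 by rewrite gt_eqF.
have pb : pos b.
  rewrite /b (_ : 1 = k^-1 *: (k *: (1 : B))); last by rewrite scalerA mulVf ?scale1r.
  by rewrite -scalerBr; apply: posZ => //; rewrite invr_ge0 ltW.
have p1b : pos (1 - b).
  rewrite /b subKr; apply: posZ; first by rewrite invr_ge0 ltW.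
  exact: pos_sqr.
have Nb : N b by apply: salgB => //; apply: salgZ => //; exact: (salgM hN).
pose y := fix y n : B := if n is m.+1 then 2^-1 *: (b + y m * y m) else 0.
have half : (0 : R[i]) <= 2^-1 by rewrite invr_ge0.
have yE n : y n.+1 = 2^-1 *: (b + y n * y n) by [].
have cb : cone b b by rewrite -[X in cone _ X]expr1; exact: cone_exp.
have cy n : cone b (y n).
  elim: n => [|n IH]; first exact: cone0.
  by rewrite yE; apply: coneZ => //; apply: coneD => //; exact: coneM.
(* The increments stay in the cone because the difference of the squares of [y n.+1] and [y n] is a
   sum of products of cone elements; hence the sequence increases. *)
have cdy n : cone b (y n.+1 - y n).
  elim: n => [|n IH]; first by rewrite subr0; exact: cy.
  rewrite [y n.+2]yE [X in _ - X]yE -scalerBr; apply: coneZ => //.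
  have -> : b + y n.+1 * y n.+1 - (b + y n * y n) =
      y n * (y n.+1 - y n) + (y n.+1 - y n) * y n.+1.
    rewrite opprD addrACA subrr add0r mulrBr mulrBl.
    by rewrite [RHS]addrC addrA subrK.
  by apply: coneD; apply: coneM.
(* The upper bound propagates since 2 (1 - y_{n+1}) = (1 - b) + (1 - y_n) + (y_n - y_n^2). *)
have p1y n : pos (1 - y n).
  elim: n => [|n IH]; first by rewrite subr0; exact: pos1.
  have -> : 1 - y n.+1 = 2^-1 *: ((1 - b) + ((1 - y n) + (y n - y n * y n))).
    have e1 : (1 : B) = (2^-1 : R[i]) *: (1 + 1 : B).
      by rewrite -mulr2n -[X in _ *: X]scaler_nat scalerA mulVf ?scale1r.
    by rewrite (addrA (1 - y n)) subrK yE [in LHS]e1 -scalerBr opprD addrACA.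
  apply: posZ => //; apply: posD => //; apply: posD => //.
  by apply: pos_subsqr => //; apply: cone_pos (cy n).
have mono n m : (n <= m)%N -> pos (y m - y n).
  move=> /subnK <-; elim: (m - n)%N => [|j IH]; first by rewrite subrr; exact: pos0.
  rewrite -(subrK (y (j + n)%N) (y (j.+1 + n)%N)) -addrA; apply: posD => //.
  exact: (cone_pos pb (cdy _)).
have [|//|n m _|Y [hY aY _]] := @mono_slim _ _ y.
- by move=> n; have [] := cone_pos pb (cy n).
- rewrite opprB addrCA addrC; apply: posD => //; exact: cone_pos (cy n).
have NY : N Y.
  apply: (salg_lim hN _ hY); elim=> [|n IH]; first exact: (salg0 hN).
  by rewrite yE; apply: salgZ => //; apply: salgD => //; exact: (salgM hN).
have YE : Y = 2^-1 *: (b + Y * Y).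
  apply: slim_uniq (slimS hY) _; apply: slimZ; apply: slimD; first exact: slim_cst.
  apply: slimM => // n u; apply: contraction => //; exact: cone_pos (cy n).
have sqY : (1 - Y) * (1 - Y) = k^-1 *: (t * t).
  have : Y + Y = b + Y * Y.
    by rewrite {1 2}YE -scalerDl -[X in (X + X) *: _]mul1r -splitr scale1r.
  rewrite -[k^-1 *: _](subKr 1) -/b => e; have -> : b = Y + Y - Y * Y by rewrite e addrK.
  by rewrite mulrBl mul1r mulrBr mulr1 !opprB opprD -addrA [- Y + _]addrCA.
have p1Y : pos (1 - Y) by apply: slim_pos p1y _; apply: slimB => //; exact: slim_cst.
exists (sqrtC k *: (1 - Y)); split.
- by apply: salgZ => //; exact: salgB.
- by apply: posZ => //; rewrite sqrtC_ge0 ltW.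
- by rewrite bopZl bopZr scalerA -expr2 sqrtCK sqY scalerA divff // scale1r.
move=> c ct; rewrite bopZl bopZr mulrBr mulrBl mulr1 mul1r; congr (_ *: (_ - _)).
have cb' : c * b = b * c.
  rewrite /b mulrBr mulrBl mulr1 mul1r bopZr bopZl mulrA ct -mulrA ct mulrA.
  by [].
apply: (slim_comm _ hY); elim=> [|n IH]; first by rewrite mulr0 mul0r.
by rewrite yE bopZr bopZl mulrDr mulrDl cb' mulrA IH -mulrA IH mulrA.
Qed.

End square_root.

(** * Zero divisors from a nonscalar self-adjoint operator *)

Section zero_divisors.
Context {R : realType} {H : hilbertSpace R}.
Local Notation B := (bop H).
Local Notation "''[' u , v ]" := (@inner R H u v).
Implicit Types (a b c x y z p q r s t : B) (N : set B).

Lemma sa_absorb p x : adj p = p -> adj x = x -> x * p = x -> p * x = x.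
Proof. by move=> ap ax xp; have := adjM x p; rewrite xp ap ax. Qed.

Lemma sa_real x u : adj x = x -> '[x u, u] = (complex.Re '[x u, u])%:C.
Proof.
move=> ax; rewrite RRe_real //; apply/CrealP; rewrite -inner_conj.
by rewrite adjE ax.
Qed.

Lemma sa_pos x : adj x = x -> (forall u, 0 <= complex.Re '[x u, u]) -> pos x.
Proof. by move=> ax h; split => // u; rewrite sa_real // ler0c. Qed.

Lemma Re_innerBZ x p (l : R) u :
  complex.Re '[(x - l%:C *: p) u, u] = complex.Re '[x u, u] - l * complex.Re '[p u, u].
Proof.
rewrite bopB bopZ innerBl innerZl ReB; congr (_ - _).
by case: '[p u, u] => i j; rewrite /= mul0r subr0.
Qed.

(* The scalar is the supremum of the [l] with [l p <= t]. *)
Lemma scalar_of_comparable p t : proj p -> adj t = t -> t * p = t ->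
  (forall l : R, pos (t - l%:C *: p) \/ pos (l%:C *: p - t)) ->
  exists l : R, t = l%:C *: p.
Proof.
move=> pp at_ tp cmp; have [ap p2] := pp.
have [p0|p0] := pselect (p = 0).
  by exists 0; rewrite -tp p0 mulr0 scaler0.
have [u u0] : exists u, 0 < complex.Re '[p u, u].
  apply/not_existsP => h; apply: p0; apply: pos_anti; first exact: proj_pos.
  apply: sa_pos; first by rewrite adjN ap.
  move=> u; rewrite bopN linearNl ReN oppr_ge0 leNgt; apply/negP; exact: h.
have sa l : adj (t - l%:C *: p) = t - l%:C *: p.
  by rewrite adjB adjZ at_ ap; congr (_ - _ *: _); exact: conjc_real.
(* Compressing [1 - k *: x] by [p] gives [p - k *: x], still positive, so that [l] is the inverse of
   [k]. *)
have up x : adj x = x -> x * p = x -> exists2 l : R, 0 < l &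
    forall u, complex.Re '[x u, u] <= l * complex.Re '[p u, u].
  move=> ax xp; have [k k0 hk] := pos_ub ax.
  have kR := complex_ge0 (ltW k0); have k0' := Re_gt0 k0.
  exists (complex.Re k)^-1; first by rewrite invr_gt0.
  move=> v; have := pos_conj p hk; rewrite mulrBr mulr1 mulrBl bopZr bopZl.
  rewrite ap p2 (sa_absorb ap ax xp) xp => -[_ /(_ v) /Re_mono].
  rewrite kR Re_innerBZ subr_ge0 => h.
  by rewrite mulrC ler_pdivlMr // mulrC.
pose L := [set l : R | pos (t - l%:C *: p)].
have [C C0 hC] := up t at_ tp.
have [D D0 hD] : exists2 l : R, 0 < l &
    forall u, complex.Re '[(- t) u, u] <= l * complex.Re '[p u, u].
  by apply: up; rewrite ?adjN ?at_ ?mulNr ?tp.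
have LE l : L l <-> forall u, l * complex.Re '[p u, u] <= complex.Re '[t u, u].
  split=> [[_ h] v|h]; first by have /Re_mono := h v; rewrite Re_innerBZ subr_ge0.
  by apply: sa_pos => // v; rewrite Re_innerBZ subr_ge0.
have p_ge0 v : 0 <= complex.Re '[p v, v].
  by have [_ /(_ v) /Re_mono] := proj_pos pp.
have Lsup : has_sup L.
  split.
    exists (- D); apply/LE => v; have := hD v; rewrite bopN linearNl ReN.
    by rewrite lerNl mulNr.
  exists C => l /LE /(_ u) h; have := le_trans h (hC u).
  by rewrite ler_pM2r.
have Lm : L (sup L).
  apply/LE => v; have [v0|v0] := ltP 0 (complex.Re '[p v, v]).
    rewrite -ler_pdivlMr //; apply: sup_le_ub; first by case: Lsup.
    by move=> l /LE /(_ v); rewrite ler_pdivlMr.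
  have v1 : complex.Re '[p v, v] = 0 by apply/eqP; rewrite eq_le v0 p_ge0.
  rewrite v1 mulr0; have := hD v; rewrite v1 mulr0 bopN linearNl ReN.
  by rewrite oppr_le0.
exists (sup L); apply/eqP; rewrite -subr_eq0; apply/eqP/pos_anti => //.
apply: sa_pos; first by rewrite adjN sa.
move=> v; rewrite bopN linearNl ReN Re_innerBZ opprB subr_ge0.
apply/ler_addgt0Pr => e e0.
have [v0|v0] := ltP 0 (complex.Re '[p v, v]); last first.
  have v1 : complex.Re '[p v, v] = 0 by apply/eqP; rewrite eq_le v0 p_ge0.
  by have := hC v; rewrite v1 !mulr0 => /le_trans; apply; rewrite add0r ltW.
(* This [l] exceeds the supremum, so comparability leaves [t <= l p]; at [v] the excess over [sup L]
   is exactly [e]. *)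
pose l := sup L + e / complex.Re '[p v, v].
have nLl : ~ L l.
  move=> /(ub_le_sup Lsup.2); rewrite /l gerDl leNgt => /negP; apply.
  by rewrite divr_gt0.
have [//|[_ /(_ v) /Re_mono]] := cmp l.
rewrite -opprB bopN linearNl ReN Re_innerBZ opprB subr_ge0.
by rewrite /l mulrDl divfK // gt_eqF.
Qed.

(* [x] and [y] are the sum and the difference of [|t - l p|] and [t - l p]. *)
Lemma zero_divisors N p t : salg N -> N 1 -> N p -> proj p -> N t -> adj t = t ->
  t * p = t -> ~ (exists k : R[i], t = k *: p) ->
  exists x y, [/\ N x, N y & [/\ x <> 0, y <> 0 & x * y = 0]] /\
    [/\ x * p = x, p * y = y &
     forall c, c * t = t * c -> c * p = p * c -> c * x = x * c].
Proof.
move=> hN N1 Np pp Nt at_ tp nsc; have [ap p2] := pp.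
apply: contrapT => nzd; apply: nsc.
suff /(scalar_of_comparable pp at_ tp) [l ->] : forall l : R,
  pos (t - l%:C *: p) \/ pos (l%:C *: p - t) by exists l%:C.
move=> l; set T := t - l%:C *: p.
have aT : adj T = T.
  by rewrite adjB adjZ at_ ap; congr (_ - _ *: _); exact: conjc_real.
have Tp : T * p = T by rewrite mulrBl tp bopZl p2.
have NT : N T by apply: salgB => //; exact: salgZ.
have [s [Ns ps ss sT]] := sqrt_of_sqr hN N1 NT aT; have [as_ _] := ps.
(* The operator [s * (1 - p)] vanishes because its square is (1 - p) T^2 (1 - p), and
   [T * p = T]. *)
have sp : s * p = s.
  apply/esym/eqP; rewrite -subr_eq0 -[X in X - _]mulr1 -mulrBr; apply/eqP/adjM0.
  rewrite adjM as_ mulrA -[_ * s * s]mulrA ss -!mulrA.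
  by rewrite (mulrBr T) mulr1 Tp subrr !mulr0.
have cT : s * T = T * s by rewrite sT.
(* If one of the two factors were zero, [- T] or [T] would equal the positive operator [s], against
   the failure of both comparisons. Their product is s^2 - T^2 = 0. *)
apply: contrapT => /not_orP [n1 n2]; apply: nzd; exists (s + T), (s - T).
split; first split.
- exact: salgD.
- exact: salgB.
- split.
  + by move=> /eqP; rewrite addr_eq0 => /eqP e; apply: n2; rewrite -opprB -/T -e.
  + by move=> /eqP; rewrite subr_eq0 => /eqP e; apply: n1; rewrite -/T -e.
  + by rewrite mulrDl (mulrBr s s) (mulrBr T s) ss cT addrA subrK subrr.
split.
- by rewrite mulrDl sp Tp.
- by rewrite (mulrBr p s) (sa_absorb ap as_ sp) (sa_absorb ap aT Tp).
move=> c ct cp; have cT' : c * T = T * c by rewrite mulrBr mulrBl ct bopZr bopZl cp.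
by rewrite mulrDr mulrDl cT' (sT _ cT').
Qed.

End zero_divisors.

(** * Traces, units of ideals, and partitions into small projections *)

Section traces.
Context {R : realType} {H : hilbertSpace R}.
Local Notation B := (bop H).
Implicit Types (a b c e p q r s x y z : B) (N J : set B).

Lemma proj_sub e (f : B) : proj e -> proj f -> f * e = e -> proj (f - e).
Proof.
move=> [ae e2] [af f2] fe; split; first by rewrite adjB ae af.
have {}ef : e * f = e by have := adjM f e; rewrite fe ae af.
by rewrite mulrBl !mulrBr f2 fe ef e2 subrr subr0.
Qed.

Lemma proj_add e (f : B) : proj e -> proj f -> e * f = 0 -> proj (e + f).
Proof.
move=> [ae e2] [af f2] ef; have fe : f * e = 0.
  by have := adjM e f; rewrite ef ae af adj0.
by split; [rewrite adjD ae af|rewrite mulrDl !mulrDr e2 f2 ef fe addr0 add0r].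
Qed.

Lemma proj_slim (f : nat -> B) : (forall n, proj (f n)) ->
  (forall n, f n.+1 * f n = f n) ->
  exists e, [/\ slim f e, proj e & forall n, e * f n = f n].
Proof.
move=> pf inc.
have incr n m : (n <= m)%N -> f m * f n = f n.
  move=> /subnK <-; elim: (m - n)%N => [|k IH]; first by have [] := pf n.
  by rewrite -{1}IH mulrA addSn inc IH.
have psub n m : (n <= m)%N -> proj (f m - f n).
  by move=> nm; apply: proj_sub => //; exact: incr.
have [|n m nm|n m nm|e [fe ae _]] := @mono_slim _ _ f.
- by move=> n; have [] := pf n.
- exact/proj_pos/psub.
- exact/proj_pos/projC/psub.
have ef n : e * f n = f n.
  by apply: slimMr_eq (slim_shift n fe) => m; rewrite incr // leq_addl.
exists e; split => //; split => //.
apply: (@slim_uniq _ _ (fun n => e * f n)); first exact: slimMl.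
by rewrite (_ : (fun n => _) = f) //; apply/funext.
Qed.

(** Stands for the real part of the given trace; normality is recorded in the form it takes for
    increasing sequences of projections. *)
Definition is_trace N (t : B -> R) :=
  [/\ (forall x y, N x -> N y -> t (x + y) = t x + t y),
      t 1 = 1,
      (forall x, N x -> 0 <= t (adj x * x)),
      (forall x, N x -> t (adj x * x) = 0 -> x = 0) &
      (forall f e, (forall n, N (f n) /\ proj (f n)) ->
        (forall n, f n.+1 * f n = f n) -> slim f e ->
        forall d : R, 0 < d -> exists n, t e - t (f n) < d)].

Section trace.
Context (N : set B) (t : B -> R).
Hypotheses (hN : salg N) (N1 : N 1) (ht : is_trace N t).

Lemma traceD x y : N x -> N y -> t (x + y) = t x + t y.
Proof. by case: ht => h _ _ _ _; exact: h. Qed.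

Lemma traceB x y : N x -> N y -> t (x - y) = t x - t y.
Proof.
by move=> Nx Ny; apply/eqP; rewrite eq_sym subr_eq -traceD ?subrK //; exact: salgB.
Qed.

Lemma trace_ge0 p : N p -> proj p -> 0 <= t p.
Proof.
by case: ht => _ _ h _ _ Np [ap p2]; have := h p Np; rewrite ap p2.
Qed.

Lemma trace_eq0 p : N p -> proj p -> t p = 0 -> p = 0.
Proof.
by case: ht => _ _ _ h _ Np [ap p2]; have := h p Np; rewrite ap p2.
Qed.

Lemma trace0 : t 0 = 0.
Proof. by have := traceB N1 N1; rewrite !subrr. Qed.

Lemma trace_le e f : N e -> N f -> proj e -> proj f -> f * e = e -> t e <= t f.
Proof.
move=> Ne Nf pe pf fe; rewrite -subr_ge0 -traceB //.
by apply: trace_ge0; [exact: salgB|exact: proj_sub].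
Qed.

Lemma trace_le1 p : N p -> proj p -> t p <= 1.
Proof.
case: (ht) => _ <- _ _ _ Np pp; apply: trace_le => //; first exact: proj1.
by rewrite mul1r.
Qed.

(** A sequential form of Zorn: each [g n.+1] dominates [g n] and comes within 1/(n+1) of the largest
    trace available above [g n]. An element of [E] above the limit then has the same trace as the
    limit, and faithfulness makes them equal. *)
Lemma maximal_projection (E : set B) : (forall e, E e -> N e /\ proj e) ->
  E !=set0 ->
  (forall f e, (forall n, E (f n)) -> (forall n, f n.+1 * f n = f n) ->
    slim f e -> proj e -> E e) ->
  exists2 e, E e & forall f, E f -> f * e = e -> f = e.
Proof.
move=> EN [e0 Ee0] Elim.
pose S e := [set t f | f in [set f | E f /\ f * e = e]].
have supS e : E e -> has_sup (S e).
  move=> Ee; split; first by exists (t e), e => //; split => //; have [_ []] := EN _ Ee.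
  by exists 1 => _ [f [/EN[Nf pf] _] <-]; exact: trace_le1.
have step (n : nat) e : exists f, E e ->
    [/\ E f, f * e = e & sup (S e) < t f + n.+1%:R^-1].
  have [Ee|nEe] := pselect (E e); last by exists e.
  have n0 : (0 : R) < n.+1%:R^-1 by rewrite invr_gt0.
  have [_ [f [Ef fe] <-] h] := sup_adherent n0 (supS e Ee).
  by exists f => _; split => //; rewrite -ltrBlDr.
have [nxt hnxt] := choice (fun ne : nat * B => step ne.1 ne.2).
pose g := fix g n := if n is k.+1 then nxt (k, g k) else e0.
have Eg n : E (g n) by elim: n => //= n IH; have [] := hnxt (n, g n) IH.
have ginc n : g n.+1 * g n = g n by have [] := hnxt (n, g n) (Eg n).
have [e [ge pe eg]] := proj_slim (fun n => (EN _ (Eg n)).2) ginc.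
have Ee : E e by exact: Elim ge pe.
exists e => // f Ef fe; have [Nf pf] := EN _ Ef; have [Ne _] := EN _ Ee.
apply/eqP; rewrite -subr_eq0; apply/eqP/trace_eq0.
- exact: salgB.
- exact: proj_sub.
apply/eqP; rewrite traceB // eq_le subr_ge0 trace_le // andbT subr_le0.
apply/ler_addgt0Pr => d d0.
have [n _ /(_ n (leqnn n)) /= hn] := near_infty_natSinv_lt (PosNum d0).
have [_ _ h] := hnxt (n, g n) (Eg n).
have tf : t f <= sup (S (g n)).
  apply: ub_le_sup; first by case: (supS _ (Eg n)).
  by exists f => //; split => //; rewrite -(eg n) mulrA fe.
apply: (le_trans tf); apply: ltW; apply: (lt_trans h); apply: ler_ltD => //.
have [Ng pg] := EN _ (Eg n.+1).
by apply: trace_le => //; exact: (eg n.+1).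
Qed.

(* If [e] is a maximal projection of [J] and [y] lies in [J], then the range
   projection of [e + y y^*] lies in [J] and dominates [e], hence equals [e]. *)
Lemma unit_of_salg J : salg J -> J `<=` N ->
  exists e, [/\ J e, proj e, forall y, J y -> e * y = y & forall y, J y -> y * e = y].
Proof.
move=> hJ JN.
have [| | |e [Je pe] emax] := @maximal_projection (J `&` proj).
- by move=> e [/JN ? ?].
- by exists 0; split; [exact: (salg0 hJ)|exact: proj0].
- by move=> f e Jf _ fe pe; split => //; apply: (salg_lim hJ _ fe) => n; case: (Jf n).
have [ae e2] := pe.
have ey y : J y -> e * y = y.
  move=> Jy; pose a := e + y * adj y.
  have py : pos (y * adj y) by have := pos_adjM (adj y); rewrite adjK.
  have Ja : J a by apply: salgD => //; apply: (salgM hJ) => //; exact: (salg_adj hJ).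
  have [r [Jr pr ra ar _]] := range_proj hJ Ja (posD (proj_pos pe) py).
  have [az z2] := projC pr; set z := 1 - r in az z2.
  have az0 : a * z = 0 by rewrite mulrBr mulr1 ar subrr.
  (* Since [z * a * z = 0] is a sum of two positive operators, both vanish. The first gives
     [e <= r], hence [r = e] by maximality; the second gives [adj y * z = 0]. *)
  have zez : pos (z * e * z) by apply: pos_conjsa => //; exact: proj_pos.
  have zyz : pos (z * (y * adj y) * z) by apply: pos_conjsa.
  have zaz : z * e * z + z * (y * adj y) * z = 0.
    by rewrite -mulrDl -mulrDr -mulrA az0 mulr0.
  have e1 : z * e * z = 0.
    apply: pos_anti => //; suff -> : - (z * e * z) = z * (y * adj y) * z by [].
    by apply/eqP; rewrite eq_sym -addr_eq0 addrC zaz.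
  have ez : e * z = 0 by apply: adjM0; rewrite adjM ae az mulrA -(mulrA z) e2.
  have er : e * r = e.
    by move/eqP: ez; rewrite mulrBr mulr1 subr_eq0 eq_sym => /eqP.
  have [ar' _] := pr.
  have re : r = e.
    by apply: emax => //; have := adjM e r; rewrite er ae ar'.
  have yz : adj y * z = 0.
    by apply: adjM0; rewrite adjM adjK az; move: zaz; rewrite e1 add0r !mulrA.
  have yr : adj y * r = adj y.
    by move/eqP: yz; rewrite mulrBr mulr1 subr_eq0 eq_sym => /eqP.
  by have := adjM (adj y) r; rewrite yr adjK ar' re => <-.
exists e; split => // y Jy; apply: (can_inj (@adjK _ _)).
by rewrite adjM ae ey //; exact: (salg_adj hJ).
Qed.

Lemma proj_scalar0 e : proj e -> e <> 0 -> forall (k : R[i]), e = k *: (1 : B) ->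
  forall x, x * e = 0 -> x = 0.
Proof.
move=> pe e0 k ek x; rewrite ek bopZr mulr1 => xe.
have k0 : k != 0 by apply/eqP => k0; apply: e0; rewrite ek k0 scale0r.
by apply: (scalerI k0); rewrite scaler0.
Qed.

Hypothesis factorN : forall z, N z -> (forall y, N y -> z * y = y * z) ->
  exists k : R[i], z = k *: (1 : B).

(** The unit [e] of a two-sided ideal is central, as [e * y = e * y * e = y * e], hence a scalar.
    The ideal [J] contains [b * adj b], so a nonzero [b] makes this scalar nonzero, and [a * e = 0]
    forces [a = 0]. *)
Lemma factor_prime a b : N a -> N b -> (forall m, N m -> a * m * b = 0) ->
  a = 0 \/ b = 0.
Proof.
move=> Na Nb h; have [b0|b0] := pselect (b = 0); [by right|left].
(* The second condition makes [J] stable under adjoints, and is closed for strong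
   limits, unlike [a * m * adj y = 0]. *)
pose J := [set y | N y /\ forall m, N m -> a * m * y = 0 /\ y * m * adj a = 0].
have hJ : salg J.
  split.
  - by split=> [|m Nm]; [exact: (salg0 hN)|rewrite mulr0 !mul0r].
  - move=> k x y [Nx hx] [Ny hy]; split; first exact: (salg_comb hN).
    move=> m Nm; have [x1 x2] := hx m Nm; have [y1 y2] := hy m Nm.
    by rewrite mulrDr !mulrDl bopZr !bopZl x1 x2 y1 y2 scaler0 addr0.
  - move=> x y [Nx hx] [Ny hy]; split; first exact: (salgM hN).
    move=> m Nm; have [x1 _] := hx m Nm; have [_ y2] := hy m Nm.
    by split; [rewrite mulrA x1 mul0r|rewrite -!mulrA (mulrA y) y2 mulr0].
  - move=> x [Nx hx]; split; first exact: (salg_adj hN).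
    move=> m Nm; have [x1 x2] := hx _ (salg_adj hN Nm).
    split; apply: (can_inj (@adjK _ _)); rewrite !adjM ?adjK adj0 mulrA //.
  - move=> f x hf fx; split; first by apply: (salg_lim hN _ fx) => n; case: (hf n).
    move=> m Nm; split.
      by apply: slimMl_eq fx => n; have [_ /(_ m Nm) []] := hf n.
    rewrite -mulrA; apply: slimMr_eq fx => n.
    by rewrite mulrA; have [_ /(_ m Nm) []] := hf n.
have [e [Je pe eJ Je']] := unit_of_salg hJ (fun y hy => hy.1).
have [Ne he] := Je.
have Jl x y : N x -> J y -> J (x * y).
  move=> Nx [Ny hy]; split; first exact: (salgM hN).
  move=> m Nm; have [y1 _] := hy _ (salgM hN Nm Nx).
  have [_ y2] := hy _ Nm; split; first by rewrite mulrA -(mulrA a) y1.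
  by rewrite -!mulrA (mulrA y) y2 mulr0.
have Jr x y : N x -> J y -> J (y * x).
  move=> Nx Jy; rewrite -(adjK (y * x)) adjM; apply: (salg_adj hJ); apply: Jl.
    exact: (salg_adj hN).
  exact: (salg_adj hJ).
have Jbb : J (b * adj b).
  split; first by apply: (salgM hN) => //; exact: (salg_adj hN).
  move=> m Nm; split; first by rewrite mulrA h // mul0r.
  have := h _ (salg_adj hN Nm) => hm; rewrite -!mulrA.
  have -> : adj b * (m * adj a) = adj (a * adj m * b) by rewrite !adjM adjK.
  by rewrite hm adj0 mulr0.
have e0 : e <> 0.
  move=> e0; apply: b0; apply: (can_inj (@adjK _ _)); rewrite adj0.
  by apply: adjM0; rewrite adjK -(eJ _ Jbb) e0 mul0r.
have [k ek] : exists k : R[i], e = k *: (1 : B).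
  by apply: factorN => // y Ny; rewrite -(Je' _ (Jr _ _ Ny Je)) -mulrA
    (eJ _ (Jl _ _ Ny Je)).
apply: (proj_scalar0 pe e0 ek).
by have [] := he _ N1; rewrite mulr1.
Qed.

End trace.
End traces.

(** * Partitions of the identity into projections of small trace *)

Section partition.
Context {R : realType} {H : hilbertSpace R}.
Local Notation B := (bop H).
Implicit Types (a b c e p q r x y z : B).
Context (N : set B) (t : B -> R).
Hypotheses (hN : salg N) (N1 : N 1) (ht : is_trace N t).

Lemma self_adjoint_parts x : exists y z,
  [/\ adj y = y, adj z = z, x = y + (- 'i%R) *: z &
   [/\ (N x -> N y /\ N z),
    (forall p, x * p = x -> p * x = x -> adj p = p -> y * p = y /\ z * p = z) &
    forall c, c * x = x * c -> c * adj x = adj x * c -> c * y = y * c /\ c * z = z * c]].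
Proof.
(* The second operator is the opposite of the usual imaginary part, which explains the coefficient
   [- 'i] in the statement. *)
exists (2^-1 *: (x + adj x)), (2^-1 *: ('i%R *: (x - adj x))).
have h2 : Num.conj (2^-1 : R[i]) = 2^-1 by rewrite geC0_conj // invr_ge0.
have ci : Num.conj ('i%R : R[i]) = - 'i%R by rewrite conjCi.
split.
- by rewrite adjZ h2 adjD adjK addrC.
- by rewrite !adjZ h2 adjB adjK ci scaleNr -scalerN opprB.
- rewrite !scalerA mulrAC mulNr -expr2 sqrCi opprK mul1r.
  rewrite -scalerDr addrACA subrr addr0 -mulr2n -[X in _ *: X]scaler_nat scalerA.
  by rewrite mulVf ?scale1r.
split.
- move=> Nx; have Nax := salg_adj hN Nx.
  by split; apply: salgZ => //; [exact: salgD|apply: salgZ => //; exact: salgB].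
- move=> p xp px ap; have axp : adj x * p = adj x.
    by have := adjM p x; rewrite px ap.
  by rewrite !bopZl mulrDl mulrBl xp axp.
- move=> c cx cax; rewrite !bopZl !bopZr mulrDl mulrDr mulrBr mulrBl cx cax.
  by [].
Qed.

(** At least one of the two self-adjoint parts of a nonscalar [x] is nonscalar. The commutation
    clause is there for [corner_center], where [x] is central in the corner and [y] has to commute
    with it too. *)
Lemma scalar_or_zero_divisors p : N p -> proj p ->
  forall x, N x -> x * p = x -> p * x = x ->
  (exists k : R[i], x = k *: p) \/
  exists y z, [/\ N y, N z & [/\ y <> 0, z <> 0 & y * z = 0]] /\
    [/\ y * p = y, p * z = z & forall c, c * x = x * c ->
     c * adj x = adj x * c -> c * p = p * c -> c * y = y * c].
Proof.
move=> Np pp x Nx xp px.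
have [y [z [ay az xE [hNyz hp hc]]]] := self_adjoint_parts x.
have [Ny Nz] := hNyz Nx; have [yp zp] := hp p xp px pp.1.
have [[k yk]|ny] := pselect (exists k : R[i], y = k *: p); last first.
  have [u [v [huv [up pv cu]]]] := zero_divisors hN N1 Np pp Ny ay yp ny.
  right; exists u, v; split => //; split => // c cx cax cp; apply: cu => //.
  by have [] := hc c cx cax.
have [[l zl]|nz] := pselect (exists k : R[i], z = k *: p); last first.
  have [u [v [huv [up pv cu]]]] := zero_divisors hN N1 Np pp Nz az zp nz.
  right; exists u, v; split => //; split => // c cx cax cp; apply: cu => //.
  by have [] := hc c cx cax.
by left; exists (k + - 'i%R * l); rewrite xE yk zl scalerA scalerDl.
Qed.

Hypothesis nonabelian : forall p, N p -> proj p -> p <> 0 ->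
  exists x y, [/\ N x, N y & p * x * p * (p * y * p) <> p * y * p * (p * x * p)].

(** A nonabelian [p] has a nonscalar compression, hence zero divisors [u * v = 0] below [p]. The
    range projection of [v * adj v] is nonzero and killed by [u], while [u * p = u] is nonzero. *)
Lemma proper_subprojection p : N p -> proj p -> p <> 0 ->
  exists q, [/\ N q, proj q, q <> 0, q <> p & p * q = q].
Proof.
move=> Np pp p0; have [ap p2] := pp.
have [x [y [Nx Ny xy]]] := nonabelian Np pp p0.
have Npxp z : N z -> N (p * z * p) by move=> Nz; apply: (salgM hN) => //; exact: (salgM hN).
have [x' [x'N x'p px' nsc]] : exists x', [/\ N x', x' * p = x', p * x' = x' &
    ~ exists k : R[i], x' = k *: p].
  apply: contrapT => h.
  have sc z : N z -> exists k : R[i], p * z * p = k *: p.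
    move=> Nz; apply: contrapT => hz; apply: h; exists (p * z * p); split => //.
    - exact: Npxp.
    - by rewrite -mulrA p2.
    - by rewrite !mulrA p2.
  have [k ek] := sc x Nx; have [l el] := sc y Ny.
  by apply: xy; rewrite ek el !bopZl !bopZr !scalerA mulrC.
have [//|[u [v [[Nu Nv [u0 v0 uv]] [up pv _]]]]] :=
  scalar_or_zero_divisors Np pp x'N x'p px'.
have pvv : pos (v * adj v) by have := pos_adjM (adj v); rewrite adjK.
have Nvv : N (v * adj v) by apply: (salgM hN) => //; exact: (salg_adj hN).
have [r [Nr pr ra ar ann]] := range_proj hN Nvv pvv.
exists r; split => //.
- move=> r0; apply: v0; apply: (can_inj (@adjK _ _)); rewrite adj0.
  by apply: adjM0; rewrite adjK -ra r0 mul0r.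
- move=> rp; apply: u0; rewrite -up -rp; apply: ann.
  by rewrite mulrA uv mul0r.
have h : (1 - p) * (v * adj v) = 0 by rewrite mulrBl mul1r mulrA pv subrr.
by have /eqP := ann _ h; rewrite mulrBl mul1r subr_eq0 eq_sym => /eqP.
Qed.

Lemma half_subprojection p : N p -> proj p -> p <> 0 ->
  exists q, [/\ N q, proj q, q <> 0, p * q = q & t q <= t p / 2].
Proof.
move=> Np pp p0; have [q [Nq pq q0 qp pq']] := proper_subprojection Np pp p0.
have Npq : N (p - q) by exact: salgB.
have [h|h] := leP (t q) (t p / 2); first by exists q.
exists (p - q); split => //.
- exact: proj_sub.
- by move=> /eqP; rewrite subr_eq0 => /eqP /esym.
- by rewrite mulrBr pq' pp.2.
rewrite (traceB hN ht) // lerBlDr -lerBlDl; apply: le_trans (ltW h).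
by rewrite {1}[t p]splitr addrK.
Qed.

Lemma small_subprojection (d : R) p : 0 < d -> N p -> proj p -> p <> 0 ->
  exists q, [/\ N q, proj q, q <> 0, p * q = q & t q <= d].
Proof.
move=> d0 Np pp p0.
(* Halving carries the bound 1/(n+1) to 1/(n+2), because n + 2 <= 2 (n + 1). *)
have step n : exists q, [/\ N q, proj q, q <> 0, p * q = q & t q <= n.+1%:R^-1].
  elim: n => [|n [q [Nq pq q0 pq' tq]]].
    by exists p; rewrite invr1; split => //; [exact: pp.2|exact: (trace_le1 hN N1 ht)].
  have [q' [Nq' pq1 q'0 qq' tq']] := half_subprojection Nq pq q0.
  exists q'; split => //; first by rewrite -qq' mulrA pq'.
  apply: (le_trans tq'); rewrite ler_pdivrMr //; apply: (le_trans tq).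
  rewrite mulrC ler_pdivlMr // mulrC ler_pdivrMr // -natrM ler_nat.
  by rewrite ltn_Pmull.
have [n _ /(_ n (leqnn n)) /= hn] := near_infty_natSinv_lt (PosNum d0).
have [q [Nq pq q0 pq' tq]] := step n; exists q; split => //.
by apply: (le_trans tq); exact: ltW.
Qed.

(** [pairwise] gives [x * y = 0] with [x] before [y]; the other order follows by adjoints. Nonzero
    members exclude repetitions, so sums over the list are sums over the set. *)
Definition orthogonal_family (s : seq B) :=
  (forall e, e \in s -> [/\ N e, proj e & e <> 0]) /\
  pairwise [rel x y | x * y == 0] s.

Lemma orthogonal_family_sum s : orthogonal_family s ->
  [/\ N (\sum_(e <- s) e), proj (\sum_(e <- s) e) &
    forall x, x \in s -> (\sum_(e <- s) e) * x = x].
Proof.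
elim: s => [|e s IH] [hs hp]; first
  by rewrite big_nil; split => //; [exact: (salg0 hN)|exact: proj0].
rewrite /= in hp; case/andP: hp => /allP he hp.
have [|Ns ps sx] := IH; first by split => // x xs; apply: hs; rewrite inE xs orbT.
have [Ne pe _] := hs e (mem_head _ _); rewrite big_cons.
have es : e * (\sum_(x <- s) x) = 0.
  by rewrite mulr_sumr big_seq big1 // => x /he /eqP.
split; [exact: salgD|exact: proj_add|].
move=> x; rewrite inE => /orP[/eqP ->|xs].
  rewrite mulrDl pe.2.
  have -> : (\sum_(x <- s) x) * e = 0.
    by have := adjM e (\sum_(x <- s) x); rewrite es adj0 pe.1 ps.1.
  by rewrite addr0.
by rewrite mulrDl sx //; have /eqP -> := he x xs; rewrite add0r.
Qed.

(** An exhaustion may pass through infinitely many projections. [E] asks only for finite families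
    that approximate [q] in trace, a condition that survives increasing limits by normality. *)
Lemma small_partition (d : R) : 0 < d -> exists s,
  [/\ orthogonal_family s, \sum_(e <- s) e = 1 & forall e, e \in s -> t e <= d].
Proof.
move=> d0.
pose small s := orthogonal_family s /\ forall e, e \in s -> t e <= d.
(* A maximal [q] exhausted by finite families of small projections must be 1. *)
pose E q := [/\ N q, proj q & forall g : R, 0 < g -> exists s,
  [/\ small s, q * (\sum_(e <- s) e) = \sum_(e <- s) e &
      t q - t (\sum_(e <- s) e) <= g]].
have [| | |e [Ne pe he] emax] := @maximal_projection _ _ N t hN N1 ht E.
- by move=> e [].
- exists 0; split; [exact: (salg0 hN)|exact: proj0|].
  move=> g g0; exists [::]; split; rewrite ?big_nil ?mulr0 ?subrr ?ltW //.
- move=> f q Ef finc fq pq; have Nq : N q.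
    by apply: (salg_lim hN _ fq) => n; case: (Ef n).
  split => // g g0; have g2 : 0 < g / 2 by rewrite divr_gt0.
  case: (ht) => _ _ _ _ /(_ f q _ finc fq _ g2) [n|n hn].
    by case: (Ef n).
  have [Nf pf /(_ _ g2) [s [ss fs ts]]] := Ef n; exists s; split => //.
    have [|q' [fq' _ q'f]] := @proj_slim _ _ f _ finc; first by move=> k; case: (Ef k).
    by rewrite (slim_uniq fq fq') -fs mulrA q'f fs.
  rewrite [g]splitr -(subrK (t (f n)) (t q)) -addrA; apply: lerD => //; exact: ltW.
have e1 : e = 1.
  apply: contrapT => ne; have pc := projC pe.
  have [||q [Nq pq q0 qe tq]] := @small_subprojection d (1 - e) d0 _ pc.
  - exact: salgB.
  - by move=> /eqP; rewrite subr_eq0 => /eqP /esym.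
  have eq0 : e * q = 0 by rewrite -qe mulrA mulrBr mulr1 pe.2 subrr mul0r.
  have qe0 : q * e = 0 by have := adjM e q; rewrite eq0 adj0 pe.1 pq.1.
  suff /emax h : E (e + q).
    apply: q0; have := h; rewrite mulrDl pe.2 qe0 addr0 => /(_ erefl) eqe.
    by apply: (addrI e); rewrite addr0.
  split; [exact: salgD|exact: proj_add|].
  move=> g g0; have [s [[os ts] es gs]] := he g g0.
  have [os1 os2] := os; have [Ns ps sx] := orthogonal_family_sum os.
  have qs : q * (\sum_(x <- s) x) = 0 by rewrite -es mulrA qe0 mul0r.
  exists (q :: s); rewrite big_cons; split.
  - split; last by move=> x; rewrite inE => /orP[/eqP ->|/ts].
    split; first by move=> x; rewrite inE => /orP[/eqP -> //|xs]; exact: os1.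
    rewrite /= os2 andbT; apply/allP => x xs /=; apply/eqP.
    by rewrite -(sx x xs) mulrA qs mul0r.
  - by rewrite !mulrDl !mulrDr es eq0 pq.2 qs addr0 add0r addrC.
  - by rewrite (traceD ht Ne Nq) (traceD ht Nq Ns) opprD addrA addrK.
(* Approximating 1 up to [d] leaves a remainder that is small itself; it completes the family unless
   it is zero. *)
have [s [[os ts] _]] := he d d0; rewrite e1.
have [os1 os2] := os; have [Ns ps sx] := orthogonal_family_sum os.
rewrite -(traceB hN ht) // => tr.
have pr := projC ps; set r := 1 - \sum_(x <- s) x in tr pr.
have [r0|r0] := pselect (r = 0).
  exists s; split => //; apply/eqP; move/eqP: r0.
  by rewrite subr_eq0 eq_sym.
exists (r :: s); split.
- split; first by move=> x; 
    rewrite inE => /orP[/eqP ->|xs]; [split => //; exact: salgB|exact: os1].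
  rewrite /= os2 andbT; apply/allP => x xs /=; apply/eqP.
  by rewrite mulrBl mul1r sx // subrr.
- by rewrite big_cons subrK.
- by move=> x; rewrite inE => /orP[/eqP ->|/ts].
Qed.

End partition.

(** * Corners of a von Neumann algebra *)

Section range_space.
Context {R : realType} {H : hilbertSpace R}.
Implicit Types (p : bop H).

(** Described by an equation rather than as an image, the space is closed by continuity of [p], so
    that completeness holds for every bounded [p]. *)
Definition fixed_vector p : {pred H} := fun u => p u == u.

Fact fixed_vector_submod p : submod_closed (fixed_vector p).
Proof.
split=> [|a u v]; first by rewrite unfold_in /fixed_vector linear0.
rewrite !unfold_in /fixed_vector => /eqP pu /eqP pv.
by apply/eqP; rewrite linearP /= pu pv.
Qed.
HB.instance Definition _ p :=
  GRing.isSubmodClosed.Build R[i] H (fixed_vector p) (fixed_vector_submod p).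

(* For a projection [p] this is the range of [p]. *)
Record fixed_space p := FixedVector
  { fixed_val :> H; fixed_valP : fixed_val \in fixed_vector p }.

HB.instance Definition _ p := [isSub for @fixed_val p].
HB.instance Definition _ p := [Choice of fixed_space p by <:].
HB.instance Definition _ p := [SubChoice_isSubLmodule of fixed_space p by <:].

Fact fixed_val_linear p : linear (@fixed_val p).
Proof. exact: (linearP (val : fixed_space p -> H)). Qed.
HB.instance Definition _ p :=
  GRing.isLinear.Build R[i] (fixed_space p) H _ (@fixed_val p) (@fixed_val_linear p).

Section norm.
Variable p : bop H.
Definition fixed_norm (u : fixed_space p) : R[i] := `|fixed_val u|.
Fact fixed_normD u v : fixed_norm (u + v) <= fixed_norm u + fixed_norm v.
Proof. by rewrite /fixed_norm raddfD ler_normD. Qed.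
Fact fixed_normZ (a : R[i]) u : fixed_norm (a *: u) = `|a| * fixed_norm u.
Proof. by rewrite /fixed_norm linearZ normrZ. Qed.
Fact fixed_norm0 u : fixed_norm u = 0 -> u = 0.
Proof. by move=> /eqP; rewrite normr_eq0 => /eqP u0; apply: val_inj. Qed.
HB.instance Definition _ := Lmodule_isNormed.Build R[i] (fixed_space p)
  fixed_normD fixed_normZ fixed_norm0.

Lemma fixed_normE (u : fixed_space p) : `|u| = `|fixed_val u|.
Proof. by []. Qed.

Fact fixed_complete (F : set_system (fixed_space p)) :
  ProperFilter F -> cauchy F -> cvg F.
Proof.
move=> PF /cauchyP cF.
have : cauchy (@fixed_val p @ F).
  apply: cauchy_exP => e e0; have [u hu] := cF e e0; exists (fixed_val u).
  rewrite /fmap /=; apply: filterS hu => v.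
  by rewrite -!ball_normE /= fixed_normE raddfB.
move=> /cauchy_cvgP /cvg_ex[l hl].
have pl : l \in fixed_vector p.
  rewrite /fixed_vector unfold_in -subr_eq0 -normr_eq0; apply/negPn/negP => h0.
  have [k k0 hk] := bop_bound p.
  have n0 : 0 < `|p l - l| by rewrite lt0r h0 normr_ge0.
  (* For a fixed vector [v], [p l - l = p (l - v) - (l - v)] has norm at most [k + 1] times that of
     [l - v]; this radius makes the estimate contradictory. *)
  have e0 : 0 < `|p l - l| / (k + 1) by rewrite divr_gt0 // ltr_wpDr.
  have /cvgrPdist_lt /(_ _ e0) hn := hl.
  have [v hv] := filter_ex hn.
  have pv : p (fixed_val v) = fixed_val v by apply/eqP; exact: (fixed_valP v).
  have : `|p l - l| < `|p l - l|; last by rewrite ltxx.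
  have {1}-> : p l - l = p (l - fixed_val v) - (l - fixed_val v).
    by rewrite linearB /= pv opprB addrA subrK.
  apply: (le_lt_trans (ler_normB _ _)).
  apply: (@le_lt_trans _ _ ((k + 1) * `|l - fixed_val v|)).
    by rewrite mulrDl mul1r lerD2r.
  by rewrite mulrC -ltr_pdivlMr // ltr_wpDr.
apply/cvg_ex; exists (FixedVector pl); apply/cvgrPdist_lt => e e0.
have /cvgrPdist_lt /(_ _ e0) := hl.
by apply: filterS => v; rewrite fixed_normE raddfB.
Qed.
HB.instance Definition _ := Uniform_isComplete.Build (fixed_space p) fixed_complete.

Definition fixed_inner (u v : fixed_space p) : R[i] := inner (fixed_val u) (fixed_val v).
Fact fixed_inner_bilinear :
  bilinear_for ( *%R : R[i] -> _) (Num.conj \; *%R) fixed_inner.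
Proof.
split=> u a v w; rewrite /fixed_inner.
  by rewrite (linearP (@fixed_val p)) innerDl innerZl.
by rewrite (linearP (@fixed_val p)) innerDr innerZr.
Qed.
HB.instance Definition _ :=
  bilinear_isBilinear.Build R[i] _ _ _ _ _ fixed_inner fixed_inner_bilinear.
Fact fixed_inner_herm (u v : fixed_space p) :
  fixed_inner u v = (-1) ^+ false * Num.conj (fixed_inner v u).
Proof. by rewrite expr0 mul1r /fixed_inner -inner_conj. Qed.
HB.instance Definition _ := isHermitianSesquilinear.Build _ _ _ _
  fixed_inner fixed_inner_herm.
Fact fixed_inner_gt0 (u : fixed_space p) : u != 0 -> 0 < fixed_inner u u.
Proof. by move=> u0; rewrite dnorm_gt0. Qed.
HB.instance Definition _ := isDotProduct.Build _ _ fixed_inner fixed_inner_gt0.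

Fact fixed_inner_norm (u : fixed_space p) : fixed_inner u u = `|u| ^+ 2.
Proof. exact: inner_norm. Qed.

Definition fixed_hilbert : hilbertSpace R :=
  @HilbertSpace R (fixed_space p) fixed_inner fixed_inner_norm.
End norm.
End range_space.

(** * Von Neumann algebras and their traces, read in the ring of operators *)

Section algebra_of_operators.
Context {R : realType} {H : hilbertSpace R}.
Local Notation B := (bop H).
Implicit Types (M : set (H -> H)).

Lemma bop_combE (k : R[i]) (x y : B) :
  (k *: x + y : B) = k *: (x : H -> H) + (y : H -> H) :> (H -> H).
Proof. by apply/funext => u; rewrite bopD bopZ. Qed.

Definition bops M : set B := [set x | M x].

Lemma vna_adjointable M T : von_neumann_algebra M -> M T -> adjointable T.
Proof.
move=> [Mb [_ _ _ Madj] _] MT; split; first exact: Mb.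
by have [S MS TS] := Madj T MT; exists S; split => //; exact: Mb.
Qed.

Lemma vna_bop M T : von_neumann_algebra M -> M T ->
  exists2 x : B, bops M x & T = x.
Proof. by move=> hM MT; exists (Bop (vna_adjointable hM MT)). Qed.

Lemma is_adjoint_adj (x : B) : is_adjoint x (adj x).
Proof. by move=> u v; exact: adjE. Qed.

Lemma vna_salg M : von_neumann_algebra M -> salg (bops M).
Proof.
move=> hM; have [Mb [M0 ML MM Madj] Mwot] := hM; split.
- exact: M0.
- by move=> k x y Mx My; rewrite -[bops M _]/(M (k *: x + y : B)) bop_combE; exact: ML.
- by move=> x y Mx My; exact: MM.
- move=> x Mx; have [S MS xS] := Madj x Mx.
  by have [y My Sy] := vna_bop hM MS; rewrite (@adj_uniq _ _ x y) // -Sy.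
move=> f x Mf fx; apply: Mwot; first exact: (bopP x).1.
move=> F e e0.
have [N hN] : exists N, forall n, (N <= n)%N ->
    {in F, forall uv, `|inner (x uv.1 - f n uv.1) uv.2| < e}.
  elim: F => [|uv F [N IH]]; first by exists 0%N.
  have [K _ hK] := cvg_inner uv.2 (fx uv.1) e0.
  exists (maxn N K) => n; rewrite geq_max => /andP[Nn Kn] w.
  rewrite inE => /orP[/eqP ->|wF]; last exact: IH.
  by rewrite innerBl; exact: hK.
by exists (f N); [exact: Mf|exact: (hN N (leqnn N))].
Qed.

Lemma self_adjoint_bop (x : B) : self_adjoint x <-> adj x = x.
Proof.
split=> [h|h]; first exact: adj_uniq.
by move=> u v; rewrite adjE h.
Qed.

Lemma projection_bop (x : B) : projection x <-> proj x.
Proof.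
split=> [[_ sx px]|[ax px]].
  by split; [exact/self_adjoint_bop|apply: bop_ext => u; have /(congr1 (@^~ u)) := px].
split; [exact: (bopP x).1|exact/self_adjoint_bop|].
by apply/funext => u; rewrite -[in RHS]px.
Qed.

(** The strong limit of an increasing sequence of projections is its least upper bound in [M],
    because the inequalities [f n <= y] pass to the limit. Normality, stated for directed sets and
    least upper bounds, thus applies to sequences. *)
Lemma trace_of_faithful M (tau : (H -> H) -> R[i]) : von_neumann_algebra M ->
  M idfun -> faithful_normal_trace M tau ->
  is_trace (bops M) (fun x : B => complex.Re (tau x)).
Proof.
move=> hM M1 [tlin t1 _ tpos tnorm]; have hN := vna_salg hM.
have tD x y : bops M x -> bops M y -> tau (x + y : B) = tau x + tau y.
  move=> Mx My; rewrite -{1}(scale1r x) bop_combE tlin ?mul1r //.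
have tp x : bops M x -> 0 <= tau (adj x * x : B) /\ (tau (adj x * x : B) = 0 -> x = 0).
  move=> Mx; have Max := salg_adj hN Mx.
  have [h1 h2] := tpos x (adj x) Mx Max (is_adjoint_adj x); split; first exact: h1.
  by move=> /h2 x0; apply: bop_ext => u; rewrite x0.
split.
- by move=> x y Mx My; rewrite tD // ReD.
- by rewrite -[bop_fun 1]/(idfun : H -> H) t1.
- by move=> x /tp[/Re_mono].
- move=> x /tp[/complex_ge0 h1 h2] t0; apply: h2.
  by rewrite h1 t0.
move=> f e Mf finc fe d d0.
have [|e' [fe' pe' ef]] := @proj_slim _ _ f _ finc; first by move=> n; case: (Mf n).
rewrite {e' fe'}(slim_uniq fe' fe) in pe' ef.
have Me : bops M e by apply: (salg_lim hN _ fe) => n; case: (Mf n).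
pose D : set (H -> H) := range (fun n => f n : H -> H).
have incr n m : (n <= m)%N -> f m * f n = f n.
  move=> /subnK <-; elim: (m - n)%N => [|k IH]; first by have [_ []] := Mf n.
  by rewrite -{1}IH mulrA addSn finc IH.
have ple (x y : B) : pos (y - x) -> op_le x y.
  by move=> [_ h] u; have := h u; rewrite bopB innerBl subr_ge0.
have psub n m : (n <= m)%N -> pos (f m - f n).
  move=> nm; apply/proj_pos/proj_sub; [by case: (Mf n)|by case: (Mf m)|exact: incr].
have -> : complex.Re (tau e) = sup [set complex.Re (tau S) | S in D].
  apply: tnorm.
  - by exists (f 0%N); exists 0%N.
  - by move=> _ [n _ <-]; case: (Mf n).
  - move=> _ [n _ <-]; have [_ /proj_pos pf] := Mf n.
    by move=> u; rewrite linear0l; have [_] := pf.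
  - move=> _ _ [n _ <-] [m _ <-]; exists (f (maxn n m)); split.
    + by exists (maxn n m).
    + by apply: ple; apply: psub; exact: leq_maxl.
    + by apply: ple; apply: psub; exact: leq_maxr.
  - split => //.
    + by apply/self_adjoint_bop; case: pe'.
    + move=> _ [n _ <-]; apply/ple/proj_pos/proj_sub => //.
      by case: (Mf n).
    + move=> y My sy fy; have [y' My' yE] := vna_bop hM My.
      rewrite yE; rewrite yE in sy fy; move/self_adjoint_bop : sy => sy.
      apply: ple; apply: (@slim_pos _ _ (fun n => y' - f n)).
        move=> n; have [_ [af _]] := Mf n; split; first by rewrite adjB sy af.
        move=> u; rewrite bopB innerBl subr_ge0; apply: fy.
        by exists n.
      by apply: slimB => //; exact: slim_cst.
set S := [set _ | _ in _].
have supS : has_sup S.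
  split; first by exists (complex.Re (tau (f 0%N))), (f 0%N) => //; exists 0%N.
  exists 1 => _ [_ [n _ <-] <-]; have [Mfn pf] := Mf n.
  have [ac c2] := projC pf; have Mc : bops M (1 - f n) by exact: salgB.
  have [/Re_mono + _] := tp _ Mc; rewrite ac c2 => h.
  have <- : complex.Re (tau (1 - f n + f n : B)) = 1 by rewrite subrK t1.
  by rewrite tD // ReD lerDr.
have [_ [_ [n _ <-] <-] h] := sup_adherent d0 supS.
by exists n; rewrite ltrBlDr addrC -ltrBlDr.
Qed.

End algebra_of_operators.

(** * Compression to the range of a projection *)

Section corner.
Context {R : realType} {H : hilbertSpace R}.
Local Notation B := (bop H).
Variables (p : B).
Hypothesis pp : proj p.
Local Notation K := (fixed_hilbert p).

Fact compress_in u : p u \in fixed_vector p.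
Proof. by rewrite unfold_in /fixed_vector -bopM pp.2. Qed.

Definition compress u : K := FixedVector (compress_in u).
Definition embed (u : K) : H := fixed_val u.
(** Extension by zero on the orthogonal complement of the range of [p]. *)
Definition inflate (y : K -> K) : H -> H := embed \o y \o compress.
(** This is [p M p] acting on the range of [p]. Defining it as a preimage lets the closure
    properties of [M] be pulled back along [inflate]. *)
Definition corner (M : set (H -> H)) : set (K -> K) := [set y | M (inflate y)].
Definition compression (y : H -> H) : K -> K := compress \o y \o embed.

Lemma embedK : cancel embed compress.
Proof. by move=> u; apply: val_inj => /=; apply/eqP; exact: (fixed_valP u). Qed.

Lemma compressK u : embed (compress u) = p u. Proof. by []. Qed.

Lemma p_embed (u : K) : p (embed u) = embed u.
Proof. by rewrite -compressK embedK. Qed.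

Lemma embed_linear : linear embed.
Proof. exact: (linearP (@fixed_val _ _ p)). Qed.

Lemma compress_linear : linear compress.
Proof.
move=> a u v; apply: val_inj; rewrite (linearP (@fixed_val _ _ p)) /=.
by rewrite linearP.
Qed.

Lemma inner_embed (u : K) v : inner (embed u) v = inner u (compress v).
Proof. by rewrite -p_embed adjE pp.1. Qed.

Lemma inner_embedr u (v : K) : inner u (embed v) = inner (compress u) v.
Proof. by rewrite inner_conj inner_embed -inner_conj. Qed.

Lemma norm_embed u : `|embed u| = `|u|. Proof. by []. Qed.

Lemma inflate_compression (x : B) : inflate (compression x) = (p * x * p : B).
Proof. by []. Qed.

Lemma inflate_inj : injective inflate.
Proof.
move=> y z yz; apply/funext => u; apply: (can_inj embedK).
by have := congr1 (@^~ (embed u)) yz; rewrite /inflate /= embedK.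
Qed.

Lemma inflate_comp y z : inflate (y \o z) = inflate y \o inflate z.
Proof. by apply/funext => u; rewrite /inflate /= embedK. Qed.

Lemma inflate_comb (k : R[i]) y z : inflate (k *: y + z) = k *: inflate y + inflate z.
Proof. by apply/funext => u; exact: embed_linear. Qed.

Lemma inflate_id : inflate idfun = p. Proof. by []. Qed.

Lemma bounded_inflate y : bounded_operator (inflate y) <-> bounded_operator y.
Proof.
have yE u : embed (y u) = inflate y (embed u) by rewrite /inflate /= embedK.
split=> [[yl [k hk]]|[yl [k hk]]].
  split.
    move=> a u v; apply: (can_inj embedK).
    by rewrite yE !embed_linear !yE yl.
  by exists k => u; rewrite -norm_embed yE.
split.
  by move=> a u v; rewrite /inflate /= compress_linear yl embed_linear.
have [k' k'0 hk'] : exists2 k' : R[i], 0 <= k' & forall u, `|y u| <= k' * `|u|.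
  by apply: bounded_ge0; split => //; exists k.
have [l l0 hl] := bop_bound p; exists (k' * l) => u.
rewrite /inflate /= norm_embed; apply: (le_trans (hk' _)); rewrite -mulrA ler_wpM2l //.
exact: hl.
Qed.

Lemma corner_vna M : von_neumann_algebra M -> von_neumann_algebra (corner M).
Proof.
move=> hM; have [Mb [M0 ML MM Madj] Mwot] := hM; split.
- by move=> y /Mb /bounded_inflate.
- split.
  + rewrite /corner /=; suff -> : inflate 0 = 0 by [].
    by apply/funext => u; exact: (linear0 (@fixed_val _ _ p)).
  + by move=> a S T MS MT; rewrite /corner /= inflate_comb; exact: ML.
  + by move=> S T MS MT; rewrite /corner /= inflate_comp; exact: MM.
  move=> S MS; have [s Ms sE] := vna_bop hM MS.
  have ps : s * p = s /\ p * s = s.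
    split; apply: bop_ext => u; rewrite bopM -sE /inflate /= ?p_embed //.
    by congr (embed (S _)); apply: val_inj; rewrite /= -bopM pp.2.
  exists (compression (adj s)).
    rewrite /corner /= inflate_compression.
    have -> : p * adj s * p = adj s.
      by apply: (can_inj (@adjK _ _)); rewrite !adjM adjK pp.1 mulrA ps.2 ps.1.
    exact: (salg_adj (vna_salg hM)).
  move=> u v; rewrite /compression /= -inner_embed -adjE -sE.
  by rewrite /inflate /= embedK.
(* Testing [inflate T] on a pair of vectors of [H] amounts to testing [T] on the compressed pair, so
   weak neighbourhoods correspond. *)
move=> T bT hT; apply: Mwot; first exact/bounded_inflate.
move=> F e e0.
have [S MS hS] := hT [seq (compress uv.1, compress uv.2) | uv <- F] e e0.
exists (inflate S) => // uv uvF.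
have := hS (compress uv.1, compress uv.2) (map_f _ uvF) => /=.
by rewrite -inner_embed.
Qed.

(** The image of a dense set under the continuous surjection [compress] is dense. *)
Lemma separable_corner : separable H -> separable K.
Proof.
move=> [S cS dS]; exists (compress @` S); first
  exact: card_le_trans (card_image_le _ _) cS.
move=> O [u Ou] oO.
have comp_cont : continuous (compress : H -> K).
  have [k k0 hk] := bop_bound p.
  move=> v; apply/cvgrPdist_lt => e e0.
  have ek : 0 < e / k by rewrite divr_gt0.
  have /cvgrPdist_lt /(_ _ ek) : v' @[v' --> v] --> v by exact: cvg_id.
  apply: filterS => w hw.
  have -> : compress v - compress w = compress (v - w).
    apply: (can_inj embedK); rewrite [LHS](raddfB (@fixed_val _ _ p)) /=.
    by rewrite linearB.
  apply: (@le_lt_trans _ _ (k * `|v - w|)); first exact: hk.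
  by rewrite mulrC -ltr_pdivlMr.
have [||v [Ov Sv]] := dS (compress @^-1` O).
- by exists (embed u); rewrite /= embedK.
- by apply: open_comp => // v _; exact: comp_cont.
by exists (compress v); split => //; exists v.
Qed.

End corner.

(** * Corners of a type II_1 factor, and generation through links *)

Section II1.
Context {R : realType} {H : hilbertSpace R}.
Local Notation B := (bop H).
Variables (M : set (H -> H)) (tau : (H -> H) -> R[i]).
Hypotheses (hM : II1_factor M) (htau : faithful_normal_trace M tau).
Local Notation N := (bops M).
Local Notation t := (fun x : B => complex.Re (tau x)).

Let vM : von_neumann_algebra M. Proof. by case: hM => -[]. Qed.
Let N1 : N 1. Proof. by case: hM => -[]. Qed.
Let hN : salg N. Proof. exact: vna_salg. Qed.
Let ht : is_trace N t. Proof. exact: trace_of_faithful. Qed.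

Lemma factorN (z : B) : N z -> (forall y : B, N y -> z * y = y * z) ->
  exists k : R[i], z = k *: (1 : B).
Proof.
case: hM => -[_ _ _ hc] _ _ Nz zc; have [|k zk] := hc z Nz.
  move=> y /(vna_bop vM)[y' Ny' ->].
  by have /(congr1 (@bop_fun _ _)) := zc y' Ny'.
by exists k; apply: bop_ext => u; rewrite zk bopZ bop1.
Qed.

Lemma nonabelianN (p : B) : N p -> proj p -> p <> 0 -> exists x y : B,
  [/\ N x, N y & p * x * p * (p * y * p) <> p * y * p * (p * x * p)].
Proof.
case: hM => _ _ hab Np pp p0; apply: contrapT => h; apply: p0; apply: bop_ext => u.
rewrite (hab p) //; split => //; first exact/projection_bop.
move=> _ _ /(vna_bop vM)[x Nx ->] /(vna_bop vM)[y Ny ->].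
apply: contrapT => xy; apply: h; exists x, y; split => // e; apply: xy.
exact: (congr1 (@bop_fun _ _) e).
Qed.

(** A nonscalar [z] would yield zero divisors [u * v = 0] below [p] with [u] commuting with the
    corner. Then [u * m * v = u * (p * m * p) * v = (p * m * p) * u * v = 0] for every [m], against
    primeness. *)
Lemma corner_center (p z : B) : N p -> proj p -> N z -> z * p = z -> p * z = z ->
  (forall y : B, N y -> z * (p * y * p) = (p * y * p) * z) ->
  exists k : R[i], z = k *: p.
Proof.
move=> Np pp Nz zp pz zc.
have [//|[u [v [[Nu Nv [u0 v0 uv]] [up pv cu]]]]] :=
  scalar_or_zero_divisors hN N1 Np pp Nz zp pz.
exfalso.
have [m Nm|//|//] := factor_prime hN N1 ht factorN Nu Nv.
have cup : u * (p * m * p) = (p * m * p) * u.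
  apply/esym/cu; first exact/esym/zc.
    apply: (can_inj (@adjK _ _)); rewrite !adjM !adjK pp.1.
    by have := zc _ (salg_adj hN Nm); rewrite !mulrA.
  by rewrite -mulrA pp.2 !mulrA pp.2.
by rewrite -up -pv !mulrA -(mulrA u p) -(mulrA u) cup -mulrA uv mulr0.
Qed.

Lemma corner_II1 (p : B) (pp : proj p) : N p -> p <> 0 ->
  II1_factor (corner pp M).
Proof.
move=> Np p0; have vK := corner_vna pp vM.
have Ninflate y : corner pp M y -> exists2 x : B, N x &
    [/\ inflate pp y = x, x * p = x & p * x = x].
  move=> My; have [x Nx xE] := vna_bop vM My; exists x => //; split => //.
    apply: bop_ext => u; rewrite bopM -xE /inflate /=.
    by congr (embed (y _)); apply: val_inj; rewrite /= -bopM pp.2.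
  by apply: bop_ext => u; rewrite bopM -xE /inflate /= p_embed.
have compressionN (x : B) : N x -> corner pp M (compression pp x).
  by move=> Nx; rewrite /corner /= inflate_compression;
    apply: (salgM hN) => //; exact: (salgM hN).
split.
- split => //.
  + move=> /(congr1 (@inflate _ _ _ pp)) h; apply: p0; apply: bop_ext => u.
    have := congr1 (@^~ u) h; rewrite inflate_id => ->.
    exact: (linear0 (@fixed_val _ _ p)).
  move=> z Mz zc; have [x Nx [zx xp px]] := Ninflate z Mz.
  have [|k xk] := corner_center Np pp Nx xp px.
    move=> y Ny; apply: bop_ext => u.
    have e : inflate pp z \o inflate pp (compression pp y) =
        inflate pp (compression pp y) \o inflate pp z.
      by rewrite -inflate_comp (zc _ (compressionN y Ny)) inflate_comp.
    by rewrite zx inflate_compression in e; exact: (congr1 (@^~ u) e).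
  exists k; apply: (@inflate_inj _ _ _ pp).
  rewrite -[k *: idfun]addr0 inflate_comb zx xk inflate_id.
  apply/funext => u; rewrite bopZ !fctE.
  by rewrite [inflate _ _ _](linear0 (@fixed_val _ _ p)) addr0.
- move=> v w Mv Mw vw wv; case: hM => _ hfin _.
  have [x Nx [vx xp px]] := Ninflate v Mv; have [y Ny [wy yp py]] := Ninflate w Mw.
  have ax : adj x = y.
    apply: adj_uniq => a b; rewrite -vx -wy /inflate /= inner_embed.
    by rewrite vw inner_embedr.
  have yx : y * x = p.
    have e : inflate pp w \o inflate pp v = inflate pp idfun by rewrite -inflate_comp wv.
    by rewrite vx wy in e; apply: bop_ext => u; exact: (congr1 (@^~ u) e).
  have pc := projC pp; have Nq : N (1 - p) by exact: salgB.
  have [q qE] : exists q, q = 1 - p by exists (1 - p).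
  rewrite -qE in pc Nq.
  have qx : q * x = 0 by rewrite qE mulrBl mul1r px subrr.
  have xq : x * q = 0 by rewrite qE mulrBr mulr1 xp subrr.
  have qy : q * y = 0 by rewrite qE mulrBl mul1r py subrr.
  have yq : y * q = 0 by rewrite qE mulrBr mulr1 yp subrr.
  (* Adding the complement [q = 1 - p] extends an isometry of the corner to one of [M], where
     finiteness is available. *)
  have h : (x + q) * (y + q) = 1.
    have yqxq : (y + q) * (x + q) = 1.
      by rewrite mulrDl !mulrDr yx yq qx pc.2 addr0 add0r qE addrC subrK.
    have e : (x + q : B) \o (y + q : B) = idfun.
      apply: hfin; [exact: (salgD hN Nx Nq)|exact: (salgD hN Ny Nq)| |].
        have -> : y + q = adj (x + q) by rewrite adjD ax pc.1.
        exact: is_adjoint_adj.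
      exact: (congr1 (@bop_fun _ _) yqxq).
    by apply: bop_ext => u; exact: (congr1 (@^~ u) e).
  have xy : x * y = p.
    move: h; rewrite mulrDl !mulrDr xq qy pc.2 addr0 add0r qE => h.
    by rewrite -[LHS](addrK (1 - p)) h subKr.
  apply: (@inflate_inj _ _ _ pp); rewrite inflate_comp vx wy inflate_id.
  exact: (congr1 (@bop_fun _ _) xy).
move=> e [Me pe eab]; have [x Nx [ex xp px]] := Ninflate e Me.
have [_ se ee] := pe.
have prx : proj x.
  split.
    apply: adj_uniq => a b; rewrite -ex /inflate /= inner_embed.
    by rewrite se inner_embedr.
  have h : inflate pp e \o inflate pp e = inflate pp e by rewrite -inflate_comp ee.
  by rewrite ex in h; apply: bop_ext => u; exact: (congr1 (@^~ u) h).
case: hM => _ _ hab; apply: (@inflate_inj _ _ _ pp); rewrite ex.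
have -> : inflate pp 0 = 0 by apply/funext => u; exact: (linear0 (@fixed_val _ _ p)).
apply: hab; split => //; first exact/projection_bop.
(* An abelian projection of the corner is abelian in [M]: elements of [M] matter only through their
   compressions, since [x] lies below [p]. *)
move=> _ _ /(vna_bop vM)[a Na ->] /(vna_bop vM)[b Nb ->].
have lE c : inflate pp (e \o compression pp c \o e) =
    inflate pp e \o inflate pp (compression pp c) \o inflate pp e.
  by rewrite (inflate_comp pp (e \o _) e) (inflate_comp pp e).
have h : inflate pp (e \o compression pp a \o e) \o
      inflate pp (e \o compression pp b \o e) =
    inflate pp (e \o compression pp b \o e) \o inflate pp (e \o compression pp a \o e).
  by rewrite -inflate_comp (eab _ _ (compressionN a Na) (compressionN b Nb)) inflate_comp.
rewrite !lE (inflate_compression pp a) (inflate_compression pp b) ex in h.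
have xpx (c : B) : x * (p * c * p) * x = x * c * x.
  by rewrite !mulrA xp -(mulrA _ p) px.
have h' : x * (p * a * p) * x * (x * (p * b * p) * x) =
    x * (p * b * p) * x * (x * (p * a * p) * x).
  by apply: bop_ext => u; exact: (congr1 (@^~ u) h).
rewrite !xpx in h'; exact: (congr1 (@bop_fun _ _) h').
Qed.

(* The [y] in [q N q] with [y N s] inside [N'] form a two-sided ideal of the factor
   [q N q], which contains [a a^*] and therefore [q]. *)
Lemma ideal_full (N' : set B) (q s a : B) : salg N' -> N q -> proj q ->
  N s -> proj s -> N a -> N' a -> a <> 0 -> q * a = a ->
  (forall y, N y -> N' (q * y * q)) -> (forall y, N y -> N' (adj a * y * s)) ->
  forall y, N y -> N' (q * y * s).
Proof.
move=> hN' Nq pq Ns ps Na N'a a0 qa hq ha.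
(* Imposing the condition on both sides of [s] makes [J] stable under adjoints: the adjoint of
   [s * m * y] is [adj y * adj m * s]. *)
pose J := [set y | [/\ N y, y * q = y, q * y = y &
  forall m, N m -> N' (y * m * s) /\ N' (s * m * y)]].
have N's y m : N m -> (forall m', N m' -> N' (y * m' * s)) -> N' (s * m * adj y).
  move=> Nm /(_ _ (salg_adj hN Nm)) /(salg_adj hN').
  by rewrite !adjM adjK ps.1 mulrA.
have adjJ y : J y -> J (adj y).
  move=> [Ny yq qy h]; split; first exact: (salg_adj hN).
  - by have := adjM q y; rewrite qy pq.1.
  - by have := adjM y q; rewrite yq pq.1.
  move=> m Nm; have [_ /(salg_adj hN')] := h _ (salg_adj hN Nm).
  rewrite !adjM adjK ps.1 mulrA => h1; split => //.
  by apply: N's => // m' /h[].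
have hJ : salg J.
  split => //.
  - split; rewrite ?mul0r ?mulr0 //; first exact: (salg0 hN).
    by move=> m _; rewrite mulr0 !mul0r; split; exact: (salg0 hN').
  - move=> k x y [Nx xq qx hx] [Ny yq qy hy]; split.
    + exact: (salg_comb hN).
    + by rewrite mulrDl bopZl xq yq.
    + by rewrite mulrDr bopZr qx qy.
    move=> m Nm; have [x1 x2] := hx m Nm; have [y1 y2] := hy m Nm.
    by rewrite !mulrDl mulrDr !bopZl bopZr; split; exact: (salg_comb hN').
  - move=> x y [Nx xq qx hx] [Ny yq qy hy]; split.
    + exact: (salgM hN).
    + by rewrite -mulrA yq.
    + by rewrite mulrA qx.
    move=> m Nm; split.
      by rewrite -(mulrA x); have [] := hx _ (salgM hN Ny Nm).
    by rewrite mulrA -(mulrA s); have [] := hy _ (salgM hN Nm Nx).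
  move=> f x Jf fx; split.
  - by apply: (salg_lim hN _ fx) => n; case: (Jf n).
  - apply: (slim_uniq _ fx); rewrite (_ : f = fun n => f n * q); first exact: slimMr.
    by apply/funext => n; case: (Jf n).
  - apply: (slim_uniq _ fx); rewrite (_ : f = fun n => q * f n); first exact: slimMl.
    by apply/funext => n; case: (Jf n).
  move=> m Nm; split.
    rewrite -mulrA.
    apply: (@salg_lim _ _ _ hN' (fun n => f n * (m * s))); last exact: slimMr.
    by move=> n; rewrite mulrA; case: (Jf n) => _ _ _ /(_ m Nm)[].
  apply: (@salg_lim _ _ _ hN' (fun n => s * m * f n)); last exact: slimMl.
  by move=> n; case: (Jf n) => _ _ _ /(_ m Nm)[].
have JN : J `<=` N by move=> y [].
have [e [Je pe eJ Je']] := unit_of_salg hN N1 ht hJ JN.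
have [Ne eq qe he] := Je.
have Jl z y : N z -> N' z -> q * z = z -> J y -> J (z * y).
  move=> Nz N'z qz [Ny yq qy hy]; split.
  - exact: (salgM hN).
  - by rewrite -mulrA yq.
  - by rewrite mulrA qz.
  move=> m Nm; split.
    rewrite -!mulrA (mulrA y); apply: (salgM hN') => //.
    by have [] := hy m Nm.
  by rewrite mulrA -(mulrA s); have [] := hy _ (salgM hN Nm Nz).
have ce m : N m -> e * (q * m * q) = (q * m * q) * e.
  move=> Nm; have Nz y : N y -> N (q * y * q).
    by move=> Ny; apply: (salgM hN) => //; exact: (salgM hN).
  have qz y : q * (q * y * q) = q * y * q by rewrite !mulrA pq.2.
  have J1 : J (q * m * q * e) by apply: Jl => //; [exact: Nz|exact: hq].
  have Nm' := salg_adj hN Nm.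
  have J2 : J (e * (q * m * q)).
    have -> : e * (q * m * q) = adj (q * adj m * q * e).
      by rewrite !adjM adjK pq.1 pe.1 !mulrA.
    by apply/adjJ/Jl => //; [exact: Nz|exact: hq].
  by rewrite -(Je' _ J2) -mulrA eJ.
have aJ : J (a * adj a).
  have Naa := salg_adj hN Na; split.
  - exact: (salgM hN).
  - by have := adjM q a; rewrite qa pq.1 -mulrA => <-.
  - by rewrite mulrA qa.
  (* Read as [a * (adj a * m * s)]: the left factor is in [N'], the right one too by [ha]. *)
  have h m : N m -> N' (a * adj a * m * s).
    move=> Nm; rewrite -!mulrA; apply: (salgM hN') => //.
    by rewrite mulrA; exact: ha.
  move=> m Nm; split; first exact: h.
  have -> : a * adj a = adj (a * adj a) by rewrite adjM adjK.
  by apply: N's => // m' Nm'; rewrite mulrA; exact: h.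
have e0 : e <> 0.
  move=> e0; apply: a0; apply: (can_inj (@adjK _ _)); rewrite adj0.
  by apply: adjM0; rewrite adjK -(eJ _ aJ) e0 mul0r.
(* As [e] commutes with the corner of [q], [e * m * (q - e)] is always zero; primeness and [e <> 0]
   leave [e = q]. *)
have [m Nm|//|/eqP] :=
    factor_prime hN N1 ht factorN Ne (salgB hN Nq Ne).
  have -> : e * m * (q - e) = e * (q * m * q) * (q - e).
    by rewrite !mulrA eq -!mulrA (mulrBr q) pq.2 qe.
  by rewrite ce // -mulrA mulrBr eq pe.2 subrr mulr0.
rewrite subr_eq0 => /eqP qE y Ny; rewrite qE.
by have [] := he y Ny.
Qed.

(** Two uses of [ideal_full]. Towards the column of [p], [adj (a q) * y * p] lies in the diagonal
    block of [p]. Towards any other [r], the adjoint of [adj (a q) * y * r] lies in the block from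
    [r] to [p], already obtained. *)
Lemma generated_by_links (L : set (H -> H)) (s : seq B) (p : B) (a : B -> B) :
  von_neumann_algebra L -> orthogonal_family N s -> \sum_(e <- s) e = 1 -> p \in s ->
  (forall q, q \in s -> forall y, N y -> bops L (q * y * q)) ->
  (forall q, q \in s ->
    [/\ N (a q), bops L (a q), a q <> 0, q * a q = a q & a q * p = a q]) ->
  M `<=` L.
Proof.
move=> vL [os _] s1 ps hq ha; have hL := vna_salg vL.
have [Np pp _] := os p ps.
have apE q : q \in s -> p * adj (a q) = adj (a q).
  by move=> /ha[_ _ _ _ ap]; have := adjM (a q) p; rewrite ap pp.1.
have step1 q y : q \in s -> N y -> bops L (q * y * p).
  move=> qs; have [Naq Laq aq0 qa ap] := ha q qs; have [Nq pq _] := os q qs.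
  apply: (ideal_full hL Nq pq Np pp Naq Laq aq0 qa); first exact: hq.
  move=> z Nz; rewrite -(apE q qs) -(mulrA p); apply: hq => //.
  by apply: (salgM hN) => //; exact: (salg_adj hN).
have step2 q r y : q \in s -> r \in s -> N y -> bops L (q * y * r).
  move=> qs rs; have [Naq Laq aq0 qa ap] := ha q qs; have [Nq pq _] := os q qs.
  have [Nr pr _] := os r rs.
  apply: (ideal_full hL Nq pq Nr pr Naq Laq aq0 qa); first exact: hq.
  move=> z Nz; rewrite -(adjK (_ * _ * _)); apply: (salg_adj hL).
  rewrite !adjM adjK pr.1 -ap mulrA mulrA; rewrite -(mulrA r); apply: step1 => //.
  by apply: (salgM hN) => //; exact: (salg_adj hN).
have sumL (f : B -> B) : (forall q, q \in s -> bops L (f q)) -> bops L (\sum_(q <- s) f q).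
  move=> hf; rewrite big_seq; apply: big_ind => //; first exact: (salg0 hL).
  by move=> u v; exact: (salgD hL).
move=> _ /(vna_bop vM)[y Ny ->].
rewrite -(mulr1 y) -s1 -[X in X * _]mul1r -s1.
suff : bops L ((\sum_(e <- s) e) * y * (\sum_(e <- s) e)) by [].
rewrite mulr_sumr; apply: (sumL _ _) => r rs; rewrite !mulr_suml; apply: sumL => q qs.
exact: step2.
Qed.

End II1.

(** * The generator invariant *)

Section generator_bound.
Context {R : realType} {H : hilbertSpace R}.
Local Notation B := (bop H).
Variables (M : set (H -> H)) (tau : (H -> H) -> R[i]).
Hypotheses (hM : II1_factor M) (htau : faithful_normal_trace M tau).
Local Notation N := (bops M).
Local Notation t := (fun x : B => complex.Re (tau x)).

Let vM : von_neumann_algebra M. Proof. by case: hM => -[]. Qed.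
Let N1 : N 1. Proof. by case: hM => -[]. Qed.
Let hN : salg N. Proof. exact: vna_salg. Qed.
Let ht : is_trace N t. Proof. exact: trace_of_faithful. Qed.

(** The corner of [L] is a von Neumann algebra on the range of [p] that contains the generator,
    hence the whole corner of [M], even when [p] is not known to be in [L]. *)
Lemma corner_generator (p : B) (pp : proj p) : N p ->
  singly_generated (corner pp M) ->
  exists x : B, [/\ N x, x * p = x, p * x = x &
    forall L, von_neumann_algebra L -> L x -> forall y, N y -> bops L (p * y * p)].
Proof.
move=> Np [x0 Mx0 Wx0]; have [x Nx xE] := vna_bop vM Mx0; exists x; split => //.
- apply: bop_ext => u; rewrite bopM -xE /inflate /=.
  by congr (embed (x0 _)); apply: val_inj; rewrite /= -bopM pp.2.
- by apply: bop_ext => u; rewrite bopM -xE /inflate /= p_embed.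
move=> L vL Lx y Ny.
have WL : Wstar [set x0] `<=` corner pp L.
  apply: smallest_sub; first exact: corner_vna.
  by move=> _ ->; rewrite /corner /= xE.
have : corner pp L (compression pp y).
  apply: WL; rewrite Wx0 /corner /= inflate_compression.
  by apply: (salgM hN) => //; exact: (salgM hN).
by rewrite /corner /= inflate_compression.
Qed.

Lemma orthogonal_familyP (s : seq B) x y : orthogonal_family N s ->
  x \in s -> y \in s -> x != y -> x * y = 0.
Proof.
elim: s => // e s IH [hs /= /andP[/allP he hp]].
have os : orthogonal_family N s by split => // z zs; apply: hs; rewrite inE zs orbT.
have [Ne [ae _] _] := hs e (mem_head _ _).
rewrite !inE => /orP[/eqP ->|xs] /orP[/eqP ->|ys]; first by rewrite eqxx.
- by move=> _; apply/eqP; exact: (he y).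
- move=> _; have := adjM e x; have [_ [-> _] _] := os.1 x xs.
  by have /eqP -> := he x xs; rewrite adj0 ae.
exact: IH.
Qed.

Lemma orthogonal_family_uniq (s : seq B) : orthogonal_family N s -> uniq s.
Proof.
elim: s => // e s IH [hs /= /andP[/allP he hp]].
apply/andP; split; last by apply: IH; split => // z zs; apply: hs; rewrite inE zs orbT.
apply/negP => es; have [_ [_ e2] e0] := hs e (mem_head _ _).
by apply: e0; rewrite -e2; apply/eqP; exact: (he e).
Qed.

Lemma bop_fun_inj : injective (@bop_fun R H).
Proof. by move=> x y xy; apply: bop_ext => u; rewrite xy. Qed.

Definition bop_partition (s : seq B) : set (H -> H) := [set` map (@bop_fun R H) s].

Lemma bop_partitionP (s : seq B) : orthogonal_family N s -> \sum_(e <- s) e = 1 ->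
  projection_partition M (bop_partition s).
Proof.
move=> os s1; split.
- exact: finite_seq.
- move=> _ /mapP[p ps ->]; have [Np pp _] := os.1 p ps; split => //.
  exact/projection_bop.
- move=> _ _ /mapP[p ps ->] /mapP[q qs ->] pq.
  have pq0 : p * q = 0.
    by apply: (orthogonal_familyP os) => //; apply/eqP => h; apply: pq; rewrite h.
  exact: (congr1 (@bop_fun R H) pq0).
rewrite /bop_partition -fsbig_seq.
  rewrite big_map.
  transitivity (bop_fun (\sum_(e <- s) e)); last by rewrite s1.
  elim: s {os s1} => [|e s IH]; first by rewrite !big_nil.
  by rewrite !big_cons IH; apply/funext => u; rewrite bopD.
rewrite map_inj_uniq; last exact: bop_fun_inj.
exact: orthogonal_family_uniq os.
Qed.

Lemma I_elt_ge0 (s : seq B) x : orthogonal_family N s ->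
  0 <= I_elt tau x (bop_partition s).
Proof.
move=> os; apply: fsumr_ge0 => -[_ _] [/= /mapP[p ps ->] /mapP[q qs ->] _].
have [Np pp _] := os.1 p ps; have [Nq pq _] := os.1 q qs.
by apply: mulr_ge0; [exact: (trace_ge0 ht Np)|exact: (trace_ge0 ht Nq)].
Qed.

(** Orthogonality leaves only the pair [(e, f)]; the inequality covers [x = 0], for which no pair
    counts. *)
Lemma I_elt_block (s : seq B) (x e f : B) : orthogonal_family N s ->
  e \in s -> f \in s -> e * x = x -> x * f = x ->
  I_elt tau x (bop_partition s) <= t e * t f.
Proof.
move=> os es fs ex xf; rewrite /I_elt.
set A := [set _ | _].
have AE : A `<=` [set (e : H -> H, f : H -> H)].
  move=> [_ _] [/= /mapP[p ps ->] /mapP[q qs ->] pxq].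
  have h : p * x * q <> 0.
    by move=> h; apply: pxq; exact: (congr1 (@bop_fun R H) h).
  have -> : p = e.
    apply: contrapT => /eqP pe; apply: h.
    by rewrite -ex mulrA (orthogonal_familyP os ps es pe) !mul0r.
  have -> // : q = f.
  apply: contrapT => /eqP; rewrite eq_sym => qf; apply: h.
  by rewrite -xf -!mulrA (orthogonal_familyP os fs qs qf) !mulr0.
have [Ne pe _] := os.1 e es; have [Nf pf _] := os.1 f fs.
have te := trace_ge0 ht Ne pe; have tf := trace_ge0 ht Nf pf.
have [->|->] := subset_set1 AE; last by rewrite fsbig_set1.
by rewrite fsbig_set0 mulr_ge0.
Qed.

(** Needed because generators taken from different families may coincide, and the set of generators
    counts them once. *)
Lemma ler_sum_undup (T : choiceType) (F : T -> R) (s : seq T) :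
  (forall x, 0 <= F x) -> \sum_(x <- undup s) F x <= \sum_(x <- s) F x.
Proof.
move=> F0; elim: s => [|x s IH]; rewrite /= ?big_nil ?big_cons //.
case: ifP => _; last by rewrite big_cons lerD2l.
by apply: (le_trans IH); rewrite lerDr.
Qed.

Lemma I_part_bound (s : seq B) (p : B) (x a : B -> B) (d : R) :
  orthogonal_family N s -> \sum_(e <- s) e = 1 -> p \in s ->
  (forall q, q \in s -> t q <= d) ->
  (forall q, q \in s -> q * x q = x q /\ x q * q = x q) ->
  (forall q, q \in s -> q * a q = a q /\ a q * p = a q) ->
  I_part tau [set` map (@bop_fun R H) (map x s ++ map a s)] (bop_partition s) <= d + d.
Proof.
move=> os s1 ps td hx ha.
set l := map _ _.
have -> : [set` l] = [set` undup l] by apply/seteqP; split => y /=; rewrite mem_undup.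
rewrite /I_part -fsbig_seq ?undup_uniq //.
apply: (le_trans (ler_sum_undup _ _)); first by move=> y; exact: I_elt_ge0.
have sum1 : \sum_(q <- s) t q = 1.
  have h (r : seq B) : {subset r <= s} ->
      N (\sum_(q <- r) q) /\ t (\sum_(q <- r) q) = \sum_(q <- r) t q.
    elim: r => [|q r IH] rs; first
      by rewrite !big_nil (trace0 hN N1 ht); split => //; exact: (salg0 hN).
    have [|Nr tr] := IH; first by move=> z zr; apply: rs; rewrite inE zr orbT.
    have [Nq _ _] := os.1 q (rs q (mem_head _ _)).
    by rewrite !big_cons -tr (traceD ht Nq Nr); split => //; exact: salgD.
  by have [_ <-] := h s (fun _ => id); rewrite s1; case: ht.
rewrite /l map_cat big_cat /= !big_map.
have t0 q : q \in s -> 0 <= t q.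
  by move=> qs; have [Nq pq _] := os.1 q qs; exact: (trace_ge0 ht Nq pq).
apply: lerD.
  rewrite -[leRHS]mulr1 -sum1 mulr_sumr big_seq [leRHS]big_seq.
  apply: ler_sum => q qs; have [qx xq] := hx q qs.
  apply: (le_trans (I_elt_block os qs qs qx xq)).
  by apply: ler_wpM2r; [exact: t0|exact: td].
rewrite -[leRHS]mul1r -sum1 mulr_suml big_seq [leRHS]big_seq.
apply: ler_sum => q qs; have [qa ap] := ha q qs.
apply: (le_trans (I_elt_block os qs ps qa ap)).
by apply: ler_wpM2l; [exact: t0|exact: td].
Qed.

Lemma generator_invariant_small (d : R) : 0 < d ->
  (forall (p : B) (pp : proj p), N p -> p <> 0 -> singly_generated (corner pp M)) ->
  (generator_invariant M tau <= (d + d)%:E)%E.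
Proof.
move=> d0 hsg.
have nonabelianN (p : B) : N p -> proj p -> p <> 0 -> exists x y : B,
  [/\ N x, N y & p * x * p * (p * y * p) <> p * y * p * (p * x * p)].
  exact: (nonabelianN hM).
have [s [os s1 ts]] := small_partition hN N1 ht nonabelianN d0.
have [p ps] : exists p, p \in s.
  case: s s1 {os ts} => [|e s _]; last by exists e; exact: mem_head.
  rewrite big_nil => h; case: hM => -[_ _ h0 _] _ _; exfalso; apply: h0.
  exact: (esym (congr1 (@bop_fun R H) h)).
have [Np pp p0] := os.1 p ps.
(* The value 0 outside [s] is a default that lets [choice] produce a total function; likewise for
   [ha]. *)
have hx q : exists x : B, q \in s -> [/\ N x, x * q = x, q * x = x &
    forall L, von_neumann_algebra L -> L x -> forall y, N y -> bops L (q * y * q)].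
  have [qs|qs] := boolP (q \in s); last by exists 0.
  have [Nq pq q0] := os.1 q qs.
  by have [x hx] := corner_generator Nq (hsg q pq Nq q0); exists x.
have ha q : exists a : B, q \in s -> [/\ N a, a <> 0, q * a = a & a * p = a].
  have [qs|qs] := boolP (q \in s); last by exists 0.
  have [Nq pq q0] := os.1 q qs.
  (* Primeness of the factor supplies the link: otherwise [q] or [p] would vanish. *)
  have [m Nm m0] : exists2 m : B, N m & q * m * p <> 0.
    apply: contrapT => h.
    have [m Nm|//|//] := factor_prime hN N1 ht (factorN hM) Nq Np.
    by apply: contrapT => h'; apply: h; exists m.
  exists (q * m * p) => _; split => //.
  - by apply: (salgM hN) => //; exact: (salgM hN).
  - by rewrite !mulrA pq.2.
  - by rewrite -mulrA pp.2.
have [x xP] := choice hx; have [a aP] := choice ha.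
set X : set (H -> H) := [set` map (@bop_fun R H) (map x s ++ map a s)].
have inX (z : B) : z \in map x s ++ map a s -> X z.
  by move=> zl; apply/mapP; exists z.
have XM : X `<=` M.
  move=> _ /mapP[z zl ->]; move: zl; rewrite mem_cat => /orP[] /mapP[q qs ->].
    by case: (xP q qs).
  by case: (aP q qs).
have WX : Wstar X = M.
  apply/seteqP; split; first exact: smallest_sub.
  move=> T MT L [vL XL].
  apply: (generated_by_links hM htau (p := p) (a := a) vL os s1 ps) MT.
    move=> q qs; have [_ _ _ h] := xP q qs; apply: h => //; apply/XL/inX.
    by rewrite mem_cat map_f.
  move=> q qs; have [Na a0 qa ap] := aP q qs; split => //; apply: XL; apply: inX.
  by rewrite mem_cat (map_f a qs) orbT.
apply: ge_ereal_inf; exists (I_set M tau X).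
  by exists X => //; split => //; exact: finite_seq.
apply: ge_ereal_inf; exists (I_part tau X (bop_partition s))%:E.
  by exists (bop_partition s) => //; exact: bop_partitionP.
rewrite lee_fin; apply: (I_part_bound (p := p)) => //.
- by move=> q qs; have [_ ? ? _] := xP q qs.
- by move=> q qs; have [_ _ ? ?] := aP q qs.
Qed.

End generator_bound.

Local Close Scope complex_scope.
Local Open Scope ereal_scope.

Theorem corollary5p1 (R : realType) :
  (exists (H : hilbertSpace R) (M : set (H -> H)) (tau : (H -> H) -> complex.complex R),
     [/\ separable H, II1_factor M, faithful_normal_trace M tau
       & 0 < generator_invariant M tau]) ->
  exists (H : hilbertSpace R) (M : set (H -> H)),
     [/\ separable H, II1_factor M & ~ singly_generated M].
Proof.
move=> [H [M [tau [sH hM htau G0]]]]; apply: contrapT => hno.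
have hsg (p : bop H) (pp : proj p) : bops M p -> p <> 0%R ->
    singly_generated (corner pp M).
  move=> Mp p0; apply: contrapT => ns; apply: hno.
  exists (fixed_hilbert p), (corner pp M); split => //.
    exact: separable_corner.
  exact: (corner_II1 hM htau).
move: G0; rewrite ltNge => /negP; apply.
(* The bound [d + d] is used with [d = e / 2]. *)
apply/lee_addgt0Pr => e e0; rewrite add0e [e]splitr.
by apply: (generator_invariant_small hM htau) => //; rewrite divr_gt0.
Qed.
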